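(* The radicals $(S_{\mathrm{Abel}}^{\mathbf{s}})^{\ast}$ and $P_{V}^{\circ}$ coincide; that is, $(S_{\mathrm{Abel}}^{\mathbf{s}})^{\ast}(\mathcal{L})=P_{V}^{\circ}(\mathcal{L})$ for every Banach Lie algebra $\mathcal{L}$.
   Context: A Banach Lie algebra is a complex Lie algebra $\mathcal{L}$ which is a Banach space in a norm such that, for some $t_{\mathcal{L}}>0$, $\|[a,b]\|\leq t_{\mathcal{L}}\|a\|\|b\|$ for all $a,b\in\mathcal{L}$. A Lie subalgebra $I$ of $\mathcal{L}$ is a Lie subideal if there are Lie subalgebras $I=J_{0}\subseteq J_{1}\subseteq\cdots\subseteq J_{n}=\mathcal{L}$ with each $J_{i}$ a Lie ideal of $J_{i+1}$; if $I$ is closed all $J_i$ can be chosen closed. $P_{V}$: a closed Lie ideal $J$ of $\mathcal{L}$ is called primitive if, for every Lie subideal $A$ of $\mathcal{L}$, $[A,A]\subseteq J$ implies $A\subseteq J$. $P_{V}(\mathcal{L})$ is the intersection of all closed primitive Lie ideals of $\mathcal{L}$. $P_{V}^{\circ}$: for $R=P_V$ put $R^{0}(\mathcal{L})=\mathcal{L}$, $R^{\alpha+1}(\mathcal{L})=R(R^{\alpha}(\mathcal{L}))$, $R^{\alpha}(\mathcal{L})=\bigcap_{\alpha'<\alpha}R^{\alpha'}(\mathcal{L})$ for limit ordinals $\alpha$; $R^{\circ}(\mathcal{L})$ is the value at which this decreasing transfinite chain of closed Lie ideals stabilizes. $S_{\mathrm{Abel}}(\mathcal{L})$ is the closed linear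 span of the union of all (closed) commutative Lie ideals of $\mathcal{L}$. $S_{\mathrm{Abel}}^{\mathbf{s}}(\mathcal{L})$ is the closed linear span of the union of all closed Lie subideals $I$ of $\mathcal{L}$ with $S_{\mathrm{Abel}}(I)=I$; it is a closed Lie ideal of $\mathcal{L}$. For $R=S_{\mathrm{Abel}}^{\mathbf{s}}$ put $R^{(0)}(\mathcal{L})=\{0\}$, $R^{(\alpha+1)}(\mathcal{L})=q_{\alpha}^{-1}\bigl(R(\mathcal{L}/R^{(\alpha)}(\mathcal{L}))\bigr)$ where $q_{\alpha}:\mathcal{L}\to\mathcal{L}/R^{(\alpha)}(\mathcal{L})$ is the quotient map, and $R^{(\alpha)}(\mathcal{L})=\overline{\bigcup_{\alpha'<\alpha}R^{(\alpha')}(\mathcal{L})}$ for limit ordinals $\alpha$; $R^{\ast}(\mathcal{L})$ is the value at which this increasing transfinite chain of closed Lie ideals stabilizes. *)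

(* Defs.v *)
From HB Require Import structures.
From mathcomp Require Import all_boot all_order all_algebra.
From mathcomp Require Import ring_quotient complex.
From mathcomp Require Import boolp classical_sets wochoice reals topology.
From mathcomp Require Import normedtype sequences.
From mathcomp Require Import ring.

Set Implicit Arguments.
Unset Strict Implicit.
Unset Printing Implicit Defensive.

Import Order.TTheory GRing.Theory Num.Theory.
Import numFieldNormedType.Exports.
Import Quotient.

Local Open Scope quotient_scope.
Local Open Scope classical_set_scope.
Local Open Scope ring_scope.
Local Open Scope complex_scope.

HB.mixin Record isBanachLie (R : realType) L
    & CompleteNormedModule R[i] L := {
  lie : L -> L -> L;
  lie_linearl : forall z a x y,
    lie (a *: x + y) z = a *: lie x z + lie y z;
  lie_linearr : forall z a x y,
    lie z (a *: x + y) = a *: lie z x + lie z y;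
  liexx : forall x, lie x x = 0;
  lie_jacobi : forall x y z,
    lie x (lie y z) + lie y (lie z x) + lie z (lie x y) = 0;
  lie_bounded : exists2 t : R, 0 < t &
    forall x y, `|lie x y| <= t%:C * `|x| * `|y|
}.

#[short(type="banachLieType")]
HB.structure Definition BanachLie (R : realType) :=
  {L of isBanachLie R L & CompleteNormedModule R[i] L}.

Section Ideals.
Context {R : realType} {L : banachLieType R}.
Implicit Types A I J S : set L.

Definition subspace S :=
  S 0 /\ forall (a : R[i]) x y, S x -> S y -> S (a *: x + y).

Definition closed_span S : set L := closure (smallest subspace S).

Definition lie_subalgebra A :=
  subspace A /\ forall x y, A x -> A y -> A (lie x y).

(* Here and in PV, SAbel and SAbel_s below, A is a Lie subalgebra of L regarded
   as a Lie algebra of its own; it must be closed in L whenever closed subsets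
   of A are involved, so that "closed in A" and "closed in L" agree. L itself is
   the case A = [set: L]. *)
Definition lie_ideal A I :=
  [/\ subspace I, I `<=` A & forall a x, A a -> I x -> I (lie a x)].

Definition lie_subideal A I :=
  exists (n : nat) (J : nat -> set L),
    [/\ J 0%N = I, J n = A,
        forall i, (i <= n)%N -> lie_subalgebra (J i) &
        forall i, (i < n)%N -> lie_ideal (J i.+1) (J i)].

Definition commutative_set I := forall x y, I x -> I y -> lie x y = 0.

Definition primitive_ideal A J :=
  [/\ closed J, lie_ideal A J &
      forall I, lie_subideal A I ->
        (forall x y, I x -> I y -> J (lie x y)) -> I `<=` J].

End Ideals.

Record closedIdeal (R : realType) (L : banachLieType R) := ClosedIdeal {
  closedIdeal_set :> set L;
  closedIdeal_closed : closed closedIdeal_set;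
  closedIdeal_ideal : lie_ideal [set: L] closedIdeal_set }.

Section QuotientAlgebra.
Context {R : realType} {L : banachLieType R} (K : closedIdeal L).
Local Notation J := (closedIdeal_set K).
Local Notation C := R[i].

Definition cideal_pred : {pred L} := fun x => `[< J x >].

Let cideal0 : J 0. Proof. by case: (closedIdeal_ideal K) => -[]. Qed.
Let cidealP a x y : J x -> J y -> J (a *: x + y).
Proof. by case: (closedIdeal_ideal K) => -[_ +] _ _; apply. Qed.
Let cidealD x y : J x -> J y -> J (x + y).
Proof. by move=> Jx Jy; rewrite -[x]scale1r; exact: cidealP. Qed.
Let cidealZ a x : J x -> J (a *: x).
Proof. by move=> Jx; rewrite -[_ *: _]addr0; exact: cidealP. Qed.
Let cidealN x : J x -> J (- x).
Proof. by rewrite -scaleN1r; exact: cidealZ. Qed.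
Let cideallie a x : J x -> J (lie a x).
Proof. by case: (closedIdeal_ideal K) => _ _ +; apply. Qed.

Fact cideal_zmod_closed : zmod_closed cideal_pred.
Proof.
split; first by apply/asboolP.
move=> x y /asboolP Jx /asboolP Jy; apply/asboolP.
by apply: cidealD => //; exact: cidealN.
Qed.

HB.instance Definition _ := GRing.isZmodClosed.Build L cideal_pred
  cideal_zmod_closed.

Definition lquot : Type := {quot cideal_pred}.
HB.instance Definition _ := GRing.Zmodule.on lquot.

Definition qmap (x : L) : lquot := \pi_{quot cideal_pred} x.

Lemma qmap_eqP x y : qmap x = qmap y <-> J (x - y).
Proof.
rewrite /qmap; split.
  by move/eqP; rewrite -idealrBE => /asboolP.
by move=> Jxy; apply/eqP; rewrite -idealrBE; apply/asboolP.
Qed.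

Lemma qmap_surj q : exists x, qmap x = q.
Proof. by exists (repr q); rewrite /qmap reprK. Qed.

Lemma qmapD x y : qmap (x + y) = qmap x + qmap y.
Proof. exact: raddfD. Qed.
Lemma qmapN x : qmap (- x) = - qmap x.
Proof. exact: raddfN. Qed.
Lemma qmapB x y : qmap (x - y) = qmap x - qmap y.
Proof. exact: raddfB. Qed.
Lemma qmap0 : qmap 0 = 0.
Proof. exact: raddf0. Qed.

Let rep (q : lquot) : L := repr q.
Let repK q : qmap (rep q) = q. Proof. exact: reprK. Qed.
Let repq x : J (rep (qmap x) - x). Proof. by apply/qmap_eqP; rewrite repK. Qed.

Definition qscale (a : C) (q : lquot) : lquot := qmap (a *: rep q).

Let qscaleE a x : qscale a (qmap x) = qmap (a *: x).
Proof. by apply/qmap_eqP; rewrite -scalerBr; apply: cidealZ. Qed.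

Fact qscaleA a b q : qscale a (qscale b q) = qscale (a * b) q.
Proof. by rewrite -[q]repK !qscaleE scalerA. Qed.
Fact qscale1 : left_id 1 qscale.
Proof. by move=> q; rewrite -[q]repK !qscaleE scale1r. Qed.
Fact qscaleDr : right_distributive qscale +%R.
Proof.
move=> a p q; rewrite -[q]repK -[p]repK -qmapD !qscaleE scalerDr.
by rewrite qmapD.
Qed.
Fact qscaleDl q : {morph qscale^~ q : a b / a + b}.
Proof. by move=> a b; rewrite -[q]repK !qscaleE scalerDl qmapD. Qed.

HB.instance Definition _ := GRing.Zmodule_isLmodule.Build C lquot
  qscaleA qscale1 qscaleDr qscaleDl.

Lemma qmapZ a x : qmap (a *: x) = a *: qmap x.
Proof. by rewrite -qscaleE. Qed.

(* The norm of a complex normed module takes its values in C; this one is the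
   infimum in R of the norms of the representatives of the coset. *)
Definition qnorm_set (q : lquot) : set R :=
  [set r | exists2 x, qmap x = q & `|x| = r%:C].

Definition qnorm (q : lquot) : C := (inf (qnorm_set q))%:C.

Let normE (x : L) : `|x| = (complex.Re `|x|)%:C.
Proof. by rewrite RRe_real// normr_real. Qed.

Let qnorm_ge0 q : lbound (qnorm_set q) 0.
Proof. by move=> r [x _ xr]; rewrite -lecR -xr normr_ge0. Qed.

Let qnorm_has_inf q : has_inf (qnorm_set q).
Proof.
split; last by exists 0.
by have [x xq] := qmap_surj q; exists (complex.Re `|x|), x.
Qed.

Lemma qnorm_le x : qnorm (qmap x) <= `|x|.
Proof.
rewrite normE lecR; apply: ge_inf; first by case: (qnorm_has_inf (qmap x)).
by exists x.
Qed.

Lemma qnorm_lift q (e : C) : qnorm q < e -> exists2 x, qmap x = q & `|x| < e.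
Proof.
move=> qe; have eR : e = (complex.Re e)%:C.
  by move: qe; rewrite ltcE => /andP[/eqP/= ie _]; case: e ie => a b /= ->.
move: qe; rewrite eR ltcR.
move=> /(inf_lt (qnorm_has_inf q).1)[r [x xq xr] re].
by exists x => //; rewrite xr ltcR.
Qed.

Let qnorm_nneg q : 0 <= qnorm q.
Proof.
rewrite lecR; apply: lb_le_inf; first by case: (qnorm_has_inf q).
exact: qnorm_ge0.
Qed.

Fact qnormD p q : qnorm (p + q) <= qnorm p + qnorm q.
Proof.
apply/ler_addgt0Pr => e e0.
have e20 : 0 < e / 2 by rewrite divr_gt0.
have [x xp lx] : exists2 x, qmap x = p & `|x| < qnorm p + e / 2.
  by apply: qnorm_lift; rewrite ltrDl.
have [y yq ly] : exists2 x, qmap x = q & `|x| < qnorm q + e / 2.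
  by apply: qnorm_lift; rewrite ltrDl.
rewrite -xp -yq -qmapD; apply: (le_trans (qnorm_le _)).
apply: (le_trans (ler_normD _ _)); rewrite xp yq.
by rewrite [e]splitr addrACA lerD// ltW.
Qed.

Let qnormZ_le a q : qnorm (a *: q) <= `|a| * qnorm q.
Proof.
have [->|a0] := eqVneq a 0.
  rewrite scale0r normr0 mul0r -qmap0 (le_trans (qnorm_le _))//.
  by rewrite normr0.
apply/ler_addgt0Pr => e e0.
have [x xq lx] : exists2 x, qmap x = q & `|x| < qnorm q + e / `|a|.
  by apply: qnorm_lift; rewrite ltrDl divr_gt0// normr_gt0.
rewrite -{1}xq -qmapZ; apply: (le_trans (qnorm_le _)).
rewrite normrZ (@le_trans _ _ (`|a| * (qnorm q + e / `|a|)))//.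
  by rewrite ler_wpM2l// ltW.
by rewrite mulrDr mulrCA divff ?mulr1 ?normr_eq0.
Qed.

Fact qnormZ a q : qnorm (a *: q) = `|a| * qnorm q.
Proof.
have [->|a0] := eqVneq a 0.
  apply/le_anti; rewrite qnormZ_le/=.
  by rewrite scale0r normr0 mul0r qnorm_nneg.
apply/le_anti; rewrite qnormZ_le/=.
have := qnormZ_le a^-1 (a *: q); rewrite scalerA mulVf// scale1r.
by rewrite normfV ler_pdivlMl ?normr_gt0.
Qed.

Fact qnorm0_eq0 q : qnorm q = 0 -> q = 0.
Proof.
have [x <-] := qmap_surj q => x0; rewrite -qmap0; apply/qmap_eqP.
rewrite subr0; apply: (closedIdeal_closed (c := K)) => U.
rewrite -nbhs_ballE => -[e /= e0 xeU].
have [y yx ye] : exists2 y, qmap y = qmap x & `|y| < e.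
  by apply: qnorm_lift; rewrite x0.
exists (x - y); split; first by apply/qmap_eqP.
by apply: xeU; rewrite -ball_normE /= opprB addrC subrK.
Qed.

HB.instance Definition _ := Lmodule_isNormed.Build C lquot
  qnormD qnormZ qnorm0_eq0.

Lemma qmap_norm_le x : `|qmap x| <= `|x|.
Proof. exact: qnorm_le. Qed.

Lemma qmap_lift q (e : C) : `|q| < e -> exists2 x, qmap x = q & `|x| < e.
Proof. exact: qnorm_lift. Qed.

Let half_small (e : C) : 0 < e -> exists n, (2^-1 : C) ^+ n < e.
Proof.
move=> e0; have eR : e = (complex.Re e)%:C by rewrite RRe_real// gtr0_real.
have r0 : 0 < complex.Re e by move: e0; rewrite eR ltcR.
pose n := (Num.truncn (complex.Re e)^-1).+1.
exists n; rewrite exprVn -[e]invrK ltf_pV2 ?posrE ?invr_gt0 ?exprn_gt0//.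
have -> : e^-1 = ((complex.Re e)^-1)%:C by rewrite {1}eR -fmorphV.
have : (complex.Re e)^-1 < 2 ^+ n.
  have: (complex.Re e)^-1 < n%:R by rewrite truncnS_gt.
  move=> /lt_trans; apply.
  by rewrite -natrX ltr_nat ltn_expl.
by rewrite -ltcR rmorphXn/= rmorph_nat.
Qed.

Fact lquot_complete (F : set_system lquot) :
  ProperFilter F -> cauchy F -> cvg F.
Proof.
move=> PF /cauchyP Fc; pose d n : C := 2^-1 ^+ n.
have d0 n : 0 < d n by rewrite exprn_gt0// invr_gt0.
have d2 n : d n.+1 + d n.+1 = d n.
  by rewrite /d exprS; field.
have /choice[a Fa] : forall n, exists q, F (ball q (d n.+1)).
  by move=> n; exact: Fc.
have aS n : `|a n.+1 - a n| < d n.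
  have [q []] := filter_ex (filterI (Fa n) (Fa n.+1)).
  rewrite -ball_normE /ball_/= => h1 h2.
  rewrite -[X in `|X|](subrKA q) (le_lt_trans (ler_normD _ _))//.
  rewrite -d2 ltrD//; last by rewrite distrC.
  by rewrite (lt_le_trans h2)// -[leRHS]d2 lerDl ltW.
have [x [xa xS]] : exists x : nat -> L,
    (forall n, qmap (x n) = a n) /\ forall n, `|x n.+1 - x n| < d n.
  have /choice[f fP] : forall nx : nat * L, exists y : L,
      qmap nx.2 = a nx.1 -> qmap y = a nx.1.+1 /\ `|y - nx.2| < d nx.1.
    move=> [n x] /=; have [xa|] := pselect (qmap x = a n); last by exists 0.
    have [y ya yd] := qmap_lift (aS n).
    by exists (y + x) => _; rewrite qmapD ya xa subrK addrK.
  have [x1 x1a] := qmap_surj (a 0%N).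
  pose x := nat_rect (fun=> L) x1 (fun n y => f (n, y)).
  have xa n : qmap (x n) = a n.
    by elim: n => //= n IH; have [] := fP (n, x n) IH.
  by exists x; split => // n; have [] := fP (n, x n) (xa n).
have xD n k : `|x (n + k)%N - x n| <= (d n - d (n + k)%N) *+ 2.
  elim: k => [|k IH]; first by rewrite addn0 !subrr normr0 mul0rn.
  rewrite addnS -[X in `|X|](subrKA (x (n + k)%N)).
  rewrite (le_trans (ler_normD _ _))// (le_trans (lerD (ltW (xS _)) IH))//.
  by rewrite -(d2 (n + k)%N) le_eqVlt; apply/orP; left; apply/eqP; ring.
have xd n k : `|x (n + k)%N - x n| <= d n *+ 2.
  rewrite (le_trans (xD n k))// ler_wMn2r// gerBl ltW//.
have xcvg : cvg (x @ \oo).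
  apply: cauchy_cvg; apply: cauchy_exP => e e0.
  have [n ne] := half_small (divr_gt0 e0 (ltr0Sn C 1)).
  exists (x n); exists n => // m /= nm.
  rewrite -ball_normE /ball_/= distrC -(subnKC nm).
  rewrite (le_lt_trans (xd _ _))// -mulr_natr -ltr_pdivlMr//.
apply/cvg_ex; exists (qmap (lim (x @ \oo))).
apply/fcvgrPdist_lt => e e0.
have e20 : 0 < e / 2 by rewrite divr_gt0.
have e60 : 0 < e / 6 by rewrite divr_gt0.
have [n ne] := half_small e60.
have [m nm xm] : exists2 m, (n <= m)%N & `|lim (x @ \oo) - x m| < e / 2.
  have [N _ NP] := @cvgr_dist_lt _ _ _ _ _ _ _ xcvg _ e20.
  by exists (maxn n N); [exact: leq_maxl|apply: NP; exact: leq_maxr].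
apply: filterS (Fa n) => q; rewrite -ball_normE /ball_/= => aq.
rewrite -[X in `|X|](subrKA (a n)) (le_lt_trans (ler_normD _ _))//.
have ae : `|qmap (lim (x @ \oo)) - a n| < e / 2 + d n *+ 2.
  rewrite -xa -qmapB (le_lt_trans (qmap_norm_le _))//.
  rewrite -[X in `|X|](subrKA (x m)) (le_lt_trans (ler_normD _ _))//.
  by rewrite ltr_leD// -(subnKC nm) xd.
rewrite (lt_trans (ltrD ae aq))//.
have dn : d n.+1 < d n by rewrite -(d2 n) ltrDl d0.
rewrite -addrA [ltRHS]splitr ltrD2l.
have -> : e / 2 = (e / 6) *+ 2 + e / 6 by field.
by rewrite ltrD ?(lt_trans dn)// ltr_pMn2r.
Qed.

HB.instance Definition _ := Uniform_isComplete.Build lquot lquot_complete.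

Definition qlie (p q : lquot) : lquot := qmap (lie (rep p) (rep q)).

Let lieDl x y z : lie (x + y) z = lie x z + lie y z :> L.
Proof. by have := lie_linearl z 1 x y; rewrite !scale1r. Qed.
Let lieDr x y z : lie z (x + y) = lie z x + lie z y :> L.
Proof. by have := lie_linearr z 1 x y; rewrite !scale1r. Qed.
Let lieC x y : lie x y = - lie y x :> L.
Proof.
apply/eqP; rewrite -addr_eq0; have := liexx (x + y).
by rewrite lieDl !lieDr !liexx add0r addr0 => ->.
Qed.

Let lieBr x y z : lie z (x - y) = lie z x - lie z y :> L.
Proof. by have := lie_linearr z (- 1) y x; rewrite !scaleN1r ![- _ + _]addrC. Qed.

Lemma qlieE x y : qlie (qmap x) (qmap y) = qmap (lie x y).
Proof.
apply/qmap_eqP; set x' := rep _; set y' := rep _.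
have -> : lie x' y' - lie x y = lie x' (y' - y) + - lie y (x' - x).
  rewrite !lieBr opprB (lieC x' y) (lieC x y) !opprK -addrA.
  by congr (_ + _); rewrite addrC subrK.
by apply: cidealD; [|apply: cidealN]; apply: cideallie; exact: repq.
Qed.

Fact qlie_linearl r a p q : qlie (a *: p + q) r = a *: qlie p r + qlie q r.
Proof.
case: (qmap_surj p) (qmap_surj q) (qmap_surj r) => x <- [y <-] [z <-].
by rewrite -qmapZ -qmapD !qlieE lie_linearl qmapD qmapZ.
Qed.

Fact qlie_linearr r a p q : qlie r (a *: p + q) = a *: qlie r p + qlie r q.
Proof.
case: (qmap_surj p) (qmap_surj q) (qmap_surj r) => x <- [y <-] [z <-].
by rewrite -qmapZ -qmapD !qlieE lie_linearr qmapD qmapZ.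
Qed.

Fact qliexx p : qlie p p = 0.
Proof. by case: (qmap_surj p) => x <-; rewrite qlieE liexx qmap0. Qed.

Fact qlie_jacobi p q r :
  qlie p (qlie q r) + qlie q (qlie r p) + qlie r (qlie p q) = 0.
Proof.
case: (qmap_surj p) (qmap_surj q) (qmap_surj r) => x <- [y <-] [z <-].
by rewrite !qlieE -!qmapD lie_jacobi qmap0.
Qed.

Fact qlie_bounded : exists2 t : R, 0 < t &
  forall p q, `|qlie p q| <= t%:C * `|p| * `|q|.
Proof.
have [t t0 tP] := @lie_bounded R L; exists t => // p q.
have tC0 : 0 < t%:C by rewrite ltcR.
pose f e : C := t%:C * (`|p| + e) * (`|q| + e).
have fP e : 0 < e -> `|qlie p q| <= f e.
  move=> e0.
  have [|x xp xe] := @qmap_lift p (`|p| + e); first by rewrite ltrDl.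
  have [|y yq ye] := @qmap_lift q (`|q| + e); first by rewrite ltrDl.
  rewrite -{1}xp -{1}yq qlieE (le_trans (qmap_norm_le _))//.
  rewrite (le_trans (tP _ _))// /f ler_pM ?mulr_ge0 ?(ltW tC0)//.
    by rewrite ler_wpM2l ?(ltW tC0)// ltW.
  exact: ltW.
apply/ler_addgt0Pr => e e0.
pose M := t%:C * (`|p| + `|q| + 1).
have M0 : 0 < M by rewrite mulr_gt0// ltr_wpDl ?addr_ge0.
pose s := e / (M + e).
have s0 : 0 < s by rewrite divr_gt0// addr_gt0.
have s1 : s <= 1 by rewrite ler_pdivrMr ?addr_gt0// mul1r lerDr ltW.
rewrite (le_trans (fP _ s0))//.
rewrite (@le_trans _ _ (t%:C * `|p| * `|q| + s * M))//; last first.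
  rewrite lerD2l /s mulrAC ler_pdivrMr ?addr_gt0// ler_pM2l// lerDl ltW//.
rewrite -subr_ge0.
have -> : t%:C * `|p| * `|q| + s * M - f s = t%:C * s * (1 - s).
  by rewrite /M /f; ring.
by rewrite mulr_ge0 ?subr_ge0 ?s1 ?(ltW (mulr_gt0 tC0 s0)).
Qed.

HB.instance Definition _ := isBanachLie.Build R lquot
  qlie_linearl qlie_linearr qliexx qlie_jacobi qlie_bounded.

Lemma qmap_lie x y : qmap (lie x y) = lie (qmap x) (qmap y).
Proof. by rewrite -qlieE. Qed.

End QuotientAlgebra.

Section Radicals.
Context {R : realType}.

Definition PV (L : banachLieType R) (A : set L) : set L :=
  \bigcap_(J in primitive_ideal A) J.

Definition SAbel (L : banachLieType R) (A : set L) : set L :=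
  closed_span (\bigcup_(I in [set I |
    [/\ closed I, lie_ideal A I & commutative_set I]]) I).

Definition SAbel_s (L : banachLieType R) (A : set L) : set L :=
  closed_span (\bigcup_(I in [set I |
    [/\ closed I, lie_subideal A I & SAbel I = I]]) I).

End Radicals.

(* Ordinals are represented by the elements of arbitrary well-ordered types
   (le is the reflexive order), so that a transfinite chain is a family indexed
   by such a type. *)
Section Ordinals.
Context {W : eqType} (le : rel W).

Definition olt v w := (v != w) && le v w.
Definition ozero w := forall v, le w v.
Definition osucc v w := olt v w /\ forall u, olt v u -> le w u.
Definition olimit w := ~ ozero w /\ ~ exists v, osucc v w.

End Ordinals.

Section TransfiniteChains.
Context {R : realType} (rad : forall L : banachLieType R, set L -> set L).
Context {L : banachLieType R}.

Definition lower_chain (W : eqType) (le : rel W) (c : W -> set L) :=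
  [/\ forall w, ozero le w -> c w = [set: L],
      forall v w, osucc le v w -> c w = rad (c v) &
      forall w, olimit le w -> c w = \bigcap_(v in [set v | olt le v w]) c v].

(* q^-1(R(L/J)) for the quotient map q *)
Definition quot_rad (J : closedIdeal L) : set L :=
  @qmap R L J @^-1` rad [set: lquot J].

Definition upper_chain (W : eqType) (le : rel W) (c : W -> closedIdeal L) :=
  [/\ forall w, ozero le w -> closedIdeal_set (c w) = [set 0],
      forall v w, osucc le v w -> closedIdeal_set (c w) = quot_rad (c v) &
      forall w, olimit le w ->
        closedIdeal_set (c w) =
        closure (\bigcup_(v in [set v | olt le v w]) closedIdeal_set (c v))].

(* rad_circ and rad_star are the values R^alpha(L) and R^(alpha)(L) at an
   ordinal alpha where the step to alpha + 1 leaves the chain unchanged. *)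
Definition rad_circ : set L :=
  [set x | exists (W : eqType) (le : rel W) (c : W -> set L) (w : W),
    [/\ well_order le, lower_chain le c, rad (c w) = c w & c w x]].

Definition rad_star : set L :=
  [set x | exists (W : eqType) (le : rel W) (c : W -> closedIdeal L) (w : W),
    [/\ well_order le, upper_chain le c, quot_rad (c w) = closedIdeal_set (c w)
      & closedIdeal_set (c w) x]].

End TransfiniteChains.

Arguments rad_circ {R} rad L.
Arguments rad_star {R} rad L.

(* Main.v *)
From mathcomp Require Import all_boot all_order all_algebra.
From mathcomp Require Import complex boolp classical_sets wochoice reals.
From mathcomp Require Import topology normedtype sequences.
From mathcomp Require Import ring lra zify.
Require Import Defs.

(** Both radicals equal [PV L], the smallest closed primitive ideal of [L] (an
    intersection of primitive ideals is primitive).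

    [SAbel_s L] is the closed span of the commutative Lie subideals of [L].
    Hence a closed ideal [K] with [SAbel_s (L / K) = 0] is exactly a primitive
    ideal, and the preimage of [SAbel_s (L / K)] stays inside every primitive
    ideal that contains [K]; so the increasing chain stabilizes at [PV L].

    The decreasing chain stabilizes at [PV L] after one step because
    [PV (PV L) = PV L]: if [Q = PV (PV L)] is an ideal of [L], then it is
    primitive in [L].

    That [Q] and [SAbel_s L] are ideals of [L] is analytic: both are closed
    subspaces invariant under the automorphisms [exp (ad b)] for all small [b],
    and [ad a] is a limit of the maps [(exp (ad (s a)) - 1) / s]. *)

Set Implicit Arguments.
Unset Strict Implicit.
Unset Printing Implicit Defensive.

Import Order.TTheory GRing.Theory Num.Theory.
Import numFieldNormedType.Exports.

Local Open Scope classical_set_scope.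
Local Open Scope ring_scope.
Local Open Scope complex_scope.

(** * The real-valued norm *)

Section RealNorm.
Context {R : realType} {L : normedModType R[i]}.
Implicit Types (x y : L) (S : set L).

(** The norm takes values in [R[i]], whose order is only partial; its real part carries the same
    information in a totally ordered field. *)
Definition nrm x : R := complex.Re `|x|.

Lemma nrmE x : `|x| = (nrm x)%:C.
Proof. by rewrite RRe_real// normr_real. Qed.

Lemma nrm_ge0 x : 0 <= nrm x.
Proof. by rewrite -lecR -nrmE normr_ge0. Qed.

Lemma nrm0_eq0 x : nrm x = 0 -> x = 0.
Proof. by move=> x0; apply/eqP; rewrite -normr_eq0 nrmE x0. Qed.

Lemma nrm0 : nrm 0 = 0. Proof. by rewrite /nrm normr0. Qed.

Lemma nrmD x y : nrm (x + y) <= nrm x + nrm y.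
Proof. by rewrite -lecR rmorphD/= -!nrmE ler_normD. Qed.

Lemma nrmN x : nrm (- x) = nrm x.
Proof. by rewrite /nrm normrN. Qed.

Lemma nrmB x y : nrm (x - y) = nrm (y - x).
Proof. by rewrite -nrmN opprB. Qed.

Lemma nrmZ (a : R) x : nrm (a%:C *: x) = `|a| * nrm x.
Proof.
apply: (@complexI R); rewrite -nrmE normrZ rmorphM/= -nrmE.
by rewrite normc_def/= expr0n addr0 sqrtr_sqr.
Qed.

Lemma nrmZC (a : R[i]) x : nrm (a *: x) = complex.Re `|a| * nrm x.
Proof.
by apply: (@complexI R); rewrite -nrmE normrZ rmorphM/= -!nrmE.
Qed.

Lemma nrm_sum (I : Type) (r : seq I) (F : I -> L) :
  nrm (\sum_(i <- r) F i) <= \sum_(i <- r) nrm (F i).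
Proof.
elim/big_rec2: _ => [|i y x _ xy]; first by rewrite nrm0.
by rewrite (le_trans (nrmD _ _))// lerD2l.
Qed.

Lemma half_lt (e : R) : 0 < e -> exists n, 2^-1 ^+ n < e.
Proof.
move=> e0; exists (Num.truncn e^-1).+1.
rewrite exprVn -[ltRHS]invrK ltf_pV2 ?posrE ?invr_gt0 ?exprn_gt0//.
by rewrite (lt_trans (truncnS_gt _))// -natrX ltr_nat ltn_expl.
Qed.

(** Identities between exponentials are obtained this way: both sides are compared through n-th
    partial sums, with errors of order 2^-n. *)
Lemma geo_eq0 C x : (forall n, nrm x <= C * 2^-1 ^+ n) -> x = 0.
Proof.
move=> xC; apply: nrm0_eq0; apply/eqP; rewrite eq_le nrm_ge0 andbT.
apply/ler_addgt0Pr => e e0; rewrite add0r.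
(* Positivity of [C] is not assumed, so a positive constant above it is used as divisor. *)
have C1 : 0 < `|C| + 1 by rewrite ltr_wpDl.
have [n ne] := half_lt (divr_gt0 e0 C1).
apply: (le_trans (xC n)); rewrite (@le_trans _ _ ((`|C| + 1) * 2^-1 ^+ n))//.
  rewrite ler_wpM2r ?exprn_ge0 ?invr_ge0//.
  by rewrite (le_trans (ler_norm _))// lerDl.
by rewrite mulrC -ler_pdivlMr// ltW.
Qed.

(** Balls have radii in [R[i]], but a positive element of [R[i]] is real, so real radii suffice. *)
Lemma closure_nrmP S x :
  closure S x <-> forall e : R, 0 < e -> exists2 y, S y & nrm (x - y) < e.
Proof.
split=> [Sx e e0|Sx U].
  have eC : 0 < e%:C by rewrite ltcR.
  have [y [Sy]] := Sx _ (nbhsx_ballx x _ eC).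
  by rewrite -ball_normE/= nrmE ltcR; exists y.
rewrite -nbhs_ballE => -[e /= e0 xeU].
have eE : e = (complex.Re e)%:C by rewrite RRe_real// gtr0_real.
have e0R : 0 < complex.Re e by rewrite -ltcR -eE.
have [y Sy xy] := Sx _ e0R.
by exists y; split => //; apply: xeU; rewrite -ball_normE/= nrmE eE ltcR.
Qed.

Lemma closed_nrm S x : closed S ->
  (forall e : R, 0 < e -> exists2 y, S y & nrm (x - y) < e) -> S x.
Proof. by move=> Sc /closure_nrmP; apply: Sc. Qed.

Lemma closed_geo S x (u : nat -> L) C : closed S -> (forall n, S (u n)) ->
  (forall n, nrm (x - u n) <= C * 2^-1 ^+ n) -> S x.
Proof.
move=> Sc Su xu; apply: closed_nrm => // e e0.
have C1 : 0 < `|C| + 1 by rewrite ltr_wpDl.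
have [n ne] := half_lt (divr_gt0 e0 C1).
exists (u n) => //; apply: (le_lt_trans (xu n)).
rewrite (@le_lt_trans _ _ ((`|C| + 1) * 2^-1 ^+ n))//.
  rewrite ler_wpM2r ?exprn_ge0 ?invr_ge0//.
  by rewrite (le_trans (ler_norm _))// lerDl.
by rewrite mulrC -ltr_pdivlMr.
Qed.

End RealNorm.

(* Both exp(b) [x, y] = [exp(b) x, exp(b) y] and exp(b) exp(-b) = 1 are obtained
   from this estimate, summing a double sequence over squares and over
   diagonals. *)
Lemma square_diagonal {R : realType} {L : normedModType R[i]}
    (z : nat -> nat -> L) (C : R) n : 0 <= C ->
  (forall i j, nrm (z i j) <= C * 4^-1 ^+ (i + j)) ->
  nrm (\sum_(i < n) \sum_(j < n) z i j
       - \sum_(k < n) \sum_(i < k.+1) z i (k - i)%N) <= 2 * C * 2^-1 ^+ n.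
Proof.
move=> C0 zC.
(* The first n diagonals fill the triangle i + j < n; what remains of the square has i + j >= n. *)
have -> : \sum_(k < n) \sum_(i < k.+1) z i (k - i)%N =
          \sum_(i < n) \sum_(j < n - i) z i j.
  elim: n => [|n IH]; first by rewrite !big_ord0.
  rewrite big_ord_recr/= IH [RHS]big_ord_recr/= big_ord_recr/= subSnn subnn.
  rewrite big_ord1 addrA -big_split/=; congr (_ + _); apply: eq_bigr => i _.
  by rewrite subSn ?(ltnW (ltn_ord i))// big_ord_recr.
rewrite -sumrB; apply: (le_trans (nrm_sum _ _)).
have bnd (i : 'I_n) : nrm (\sum_(j < n) z i j - \sum_(j < n - i) z i j) <=
    n%:R * (C * 4^-1 ^+ n).
  have -> : \sum_(j < n) z i j = \sum_(j < n - i) z i j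
      + \sum_(j < i) z i (n - i + j)%N.
    have S m p : \sum_(j < m + p) z i j
        = \sum_(j < m) z i j + \sum_(j < p) z i (m + j)%N.
      by rewrite big_split_ord.
    by rewrite -S (subnK (ltnW (ltn_ord i))).
  rewrite addrC addKr (le_trans (nrm_sum _ _))//.
  rewrite (@le_trans _ _ (\sum_(j < i) C * 4^-1 ^+ n))//; last first.
    rewrite sumr_const card_ord -[leLHS]mulr_natl ler_wpM2r//.
      by rewrite mulr_ge0// exprn_ge0// invr_ge0.
    by rewrite ler_nat ltnW.
  apply: ler_sum => j _; apply: (le_trans (zC _ _)); rewrite ler_wpM2l//.
  apply: ler_wiXn2l; rewrite ?invr_ge0 ?invf_le1 ?ler1n//.
  by rewrite addnA subnKC ?leq_addr// ltnW.
apply: (@le_trans _ _ (\sum_(i < n) n%:R * (C * 4^-1 ^+ n))).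
  by apply: ler_sum => i _; exact: bnd.
rewrite sumr_const card_ord -[leLHS]mulr_natl.
(* At most n^2 terms of size [C] 4^-n remain; this bound on n^2 costs only one of the two factors
   2^-n. *)
have nn : n%:R * n%:R <= 2 * 2 ^+ n :> R.
  rewrite -natrX -!natrM ler_nat.
  elim: n {z zC bnd} => // -[//|[//|[//|n IH]]].
  by rewrite expnS; nia.
rewrite mulrA mulrCA [leRHS]mulrAC mulrC ler_wpM2r//.
have -> : 4^-1 = 2^-1 * 2^-1 :> R by field.
rewrite exprMn mulrA ler_wpM2r ?exprn_ge0 ?invr_ge0//.
by rewrite exprVn ler_pdivrMr ?exprn_gt0.
Qed.

(** * Exponentials of inner derivations *)

Section LieBracket.
Context {R : realType} {L : banachLieType R}.
Implicit Types (x y z : L) (a : R[i]).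

Lemma lieDl x y z : lie (x + y) z = lie x z + lie y z.
Proof. by have := lie_linearl z 1 x y; rewrite !scale1r. Qed.

Lemma lieDr x y z : lie z (x + y) = lie z x + lie z y.
Proof. by have := lie_linearr z 1 x y; rewrite !scale1r. Qed.

Lemma lie0l z : lie 0 z = 0.
Proof. by apply: (addrI (lie 0 z)); rewrite -lieDl !addr0. Qed.

Lemma lie0r z : lie z 0 = 0.
Proof. by apply: (addrI (lie z 0)); rewrite -lieDr !addr0. Qed.

Lemma lieZl a x z : lie (a *: x) z = a *: lie x z.
Proof. by have := lie_linearl z a x 0; rewrite lie0l !addr0. Qed.

Lemma lieZr a x z : lie z (a *: x) = a *: lie z x.
Proof. by have := lie_linearr z a x 0; rewrite lie0r !addr0. Qed.

Lemma lieNl x z : lie (- x) z = - lie x z.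
Proof. by rewrite -scaleN1r lieZl scaleN1r. Qed.

Lemma lieNr x z : lie z (- x) = - lie z x.
Proof. by rewrite -scaleN1r lieZr scaleN1r. Qed.

Lemma lieBl x y z : lie (x - y) z = lie x z - lie y z.
Proof. by rewrite lieDl lieNl. Qed.

Lemma lieBr x y z : lie z (x - y) = lie z x - lie z y.
Proof. by rewrite lieDr lieNr. Qed.

Lemma lieC x y : lie x y = - lie y x.
Proof.
apply/eqP; rewrite -addr_eq0; have := liexx (x + y).
by rewrite lieDl !lieDr !liexx add0r addr0 => ->.
Qed.

Lemma lie_suml (I : Type) (r : seq I) (F : I -> L) z :
  lie (\sum_(i <- r) F i) z = \sum_(i <- r) lie (F i) z.
Proof.
by apply: (big_morph (fun x => lie x z)) => [x y|]; rewrite (lieDl, lie0l).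
Qed.

Lemma lie_sumr (I : Type) (r : seq I) (F : I -> L) z :
  lie z (\sum_(i <- r) F i) = \sum_(i <- r) lie z (F i).
Proof. by apply: (big_morph (lie z)) => [x y|]; rewrite (lieDr, lie0r). Qed.

Lemma lie_derivation z x y : lie z (lie x y) = lie (lie z x) y + lie x (lie z y).
Proof.
apply/eqP; rewrite -subr_eq0 opprD addrA -(lie_jacobi z x y).
by rewrite [lie (lie z x) y]lieC opprK [lie z y]lieC lieNr opprK addrAC.
Qed.

Lemma lie_nrm : exists2 t : R, 0 < t &
  forall x y, nrm (lie x y) <= t * nrm x * nrm y.
Proof.
have [t t0 tP] := @lie_bounded R L; exists t => // x y.
by rewrite -lecR !rmorphM/= -!nrmE.
Qed.

End LieBracket.

Section Exponential.
Context {R : realType} {L : banachLieType R}.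
Implicit Types (x y : L) (S : set L) (b : L).

Definition exp_term b k x : L := k`!%:R^-1 *: iter k (lie b) x.

Definition exp_sum b n x : L := \sum_(k < n) exp_term b k x.

(** The sum of the exponential series of [ad b] at [x]. Convergence is established below when [ad b]
    has operator norm at most 1/4. *)
Definition lie_exp b x : L := lim (exp_sum b n x @[n --> \oo]).

Lemma exp_term0 b x : exp_term b 0 x = x.
Proof. by rewrite /exp_term invr1 scale1r. Qed.

Lemma exp_term_linear b k (a : R[i]) x y :
  exp_term b k (a *: x + y) = a *: exp_term b k x + exp_term b k y.
Proof.
rewrite /exp_term; have -> : iter k (lie b) (a *: x + y) =
    a *: iter k (lie b) x + iter k (lie b) y.
  by elim: k => //= k ->; rewrite lie_linearr.
by rewrite scalerDr !scalerA mulrC.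
Qed.

Lemma exp_term0r b k : exp_term b k 0 = 0.
Proof.
rewrite /exp_term; have -> : iter k (lie b) 0 = 0 :> L; last exact: scaler0.
by elim: k => //= k ->; rewrite lie0r.
Qed.

Lemma exp_termZ b k (a : R[i]) x : exp_term b k (a *: x) = a *: exp_term b k x.
Proof. by have := exp_term_linear b k a x 0; rewrite exp_term0r !addr0. Qed.

Lemma exp_term_sum b k (I : Type) (r : seq I) (F : I -> L) :
  exp_term b k (\sum_(i <- r) F i) = \sum_(i <- r) exp_term b k (F i).
Proof.
apply: big_morph => [x y|]; last exact: exp_term0r.
by have := exp_term_linear b k 1 x y; rewrite !scale1r.
Qed.

(** This recursion, cleared of denominators, yields the product rule, the inversion formula and the
    norm bound for the terms. *)
Lemma exp_termS b k x : k.+1%:R *: exp_term b k.+1 x = lie b (exp_term b k x).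
Proof.
rewrite /exp_term factS natrM invfM scalerA mulrA divff ?pnatr_eq0// mul1r.
by rewrite lieZr.
Qed.

Lemma exp_term_lieC b k x : exp_term b k (lie b x) = lie b (exp_term b k x).
Proof. by rewrite /exp_term lieZr -iterSr iterS. Qed.

Lemma exp_sum_linear b n (a : R[i]) x y :
  exp_sum b n (a *: x + y) = a *: exp_sum b n x + exp_sum b n y.
Proof.
rewrite /exp_sum scaler_sumr -big_split; apply: eq_bigr => k _.
exact: exp_term_linear.
Qed.

Lemma exp_sumB b n x y : exp_sum b n (x - y) = exp_sum b n x - exp_sum b n y.
Proof.
by rewrite addrC -scaleN1r exp_sum_linear scaleN1r addrC.
Qed.

(* Multiplying by k turns a sum over i + j = k into the same sum with weights
   i and j. *)
Lemma weighted_sum (w : nat -> nat -> L) k :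
  k.+1%:R *: (\sum_(i < k.+2) w i (k.+1 - i)%N) =
  (\sum_(i < k.+1) i.+1%:R *: w i.+1 (k - i)%N)
  + \sum_(i < k.+1) (k - i).+1%:R *: w i (k - i).+1 :> L.
Proof.
have -> : \sum_(i < k.+1) i.+1%:R *: w i.+1 (k - i)%N =
    \sum_(i < k.+2) i%:R *: w i (k.+1 - i)%N.
  by rewrite [RHS]big_ord_recl scale0r add0r; apply: eq_bigr => i _; rewrite subSS.
have -> : \sum_(i < k.+1) (k - i).+1%:R *: w i (k - i).+1 =
    \sum_(i < k.+2) (k.+1 - i)%:R *: w i (k.+1 - i)%N.
  rewrite [RHS]big_ord_recr/= subnn scale0r addr0; apply: eq_bigr => i _.
  by rewrite subSn// -ltnS.
rewrite -big_split scaler_sumr; apply: eq_bigr => i _ /=.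
by rewrite -scalerDl -natrD subnKC// -ltnS.
Qed.

(** Leibniz rule of order k for the derivation [ad b], divided by k!. In the inductive step,
    multiplying by k+1 lets [weighted_sum] split the right-hand side into the two sums that the
    derivation produces. *)
Lemma exp_term_lie b k x y : exp_term b k (lie x y) =
  \sum_(i < k.+1) lie (exp_term b i x) (exp_term b (k - i) y).
Proof.
elim: k => [|k IH]; first by rewrite big_ord1 !exp_term0.
have k0 : k.+1%:R != 0 :> R[i] by rewrite pnatr_eq0.
apply: (scalerI k0); rewrite exp_termS IH.
rewrite (weighted_sum (fun i j => lie (exp_term b i x) (exp_term b j y))).
rewrite lie_sumr -big_split; apply: eq_bigr => i _ /=.
by rewrite -lieZl -lieZr !exp_termS lie_derivation.
Qed.

(** The part of degree k of exp(b) exp(-b). After multiplication by k+1, raising the left index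
    contributes [ad b] and raising the right index contributes its negative, so the two sums
    cancel. *)
Lemma exp_term_inv b k x :
  \sum_(i < k.+1) exp_term b i (exp_term (- b) (k - i) x) = if k is 0%N then x else 0.
Proof.
case: k => [|k]; first by rewrite big_ord1 !exp_term0.
have k0 : k.+1%:R != 0 :> R[i] by rewrite pnatr_eq0.
apply: (scalerI k0); rewrite scaler0.
rewrite (weighted_sum (fun i j => exp_term b i (exp_term (- b) j x))).
rewrite -big_split big1// => i _ /=.
by rewrite exp_termS -exp_term_lieC -exp_termZ exp_termS lieNl
  -[- lie _ _]scaleN1r
  exp_termZ scaleN1r subrr.
Qed.

(** * Convergence and multiplicativity of the exponential for small [ad b] *)

Section Bounded.
Variables (b : L) (M : R).
Hypothesis bM : forall x, nrm (lie b x) <= M * nrm x.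
Hypotheses (M0 : 0 <= M) (M4 : M <= 4^-1).

Let le_half : M <= 2^-1.
Proof. by rewrite (le_trans M4)// lef_pV2 ?posrE// ler_nat. Qed.

Lemma exp_term_le k x : nrm (exp_term b k x) <= M ^+ k * nrm x.
Proof.
elim: k => [|k IH]; first by rewrite exp_term0 expr0 mul1r.
have k0 : k.+1%:R != 0 :> R[i] by rewrite pnatr_eq0.
have : nrm (k.+1%:R *: exp_term b k.+1 x) <= M ^+ k.+1 * nrm x.
  rewrite exp_termS (le_trans (bM _))// exprS -mulrA.
  by rewrite ler_wpM2l.
have -> : k.+1%:R = (k.+1%:R : R)%:C :> R[i] by rewrite rmorph_nat.
apply: le_trans; rewrite nrmZ ger0_norm ?ler0n//.
by rewrite ler_peMl ?nrm_ge0// ler1n.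
Qed.

(** The bound telescopes in k: M^m is at most 2 (M^m - M^(m+1)) because M is at most 1/2. *)
Lemma exp_sum_tail n k x :
  nrm (exp_sum b (n + k) x - exp_sum b n x) <= 2 * (M ^+ n - M ^+ (n + k)) * nrm x.
Proof.
elim: k => [|k IH]; first by rewrite addn0 !subrr mulr0 mul0r nrm0.
rewrite addnS {1}/exp_sum big_ord_recr/= -/(exp_sum b (n + k) x) addrAC.
rewrite (le_trans (nrmD _ _))// (le_trans (lerD IH (exp_term_le _ _)))//.
rewrite -mulrDl ler_wpM2r ?nrm_ge0// exprS.
have E0 := exprn_ge0 (n + k) M0.
have : 0 <= M ^+ (n + k) * (4^-1 - M) by rewrite mulr_ge0// subr_ge0.
rewrite mulrBr; lra.
Qed.

(** [exp_sum_tail] makes the partial sums Cauchy, hence convergent by completeness, and its bound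
    passes to the limit in k. *)
Lemma lie_exp_le n x : nrm (lie_exp b x - exp_sum b n x) <= 2 * M ^+ n * nrm x.
Proof.
have tail m k : nrm (exp_sum b (m + k) x - exp_sum b m x) <= 2 * M ^+ m * nrm x.
  rewrite (le_trans (exp_sum_tail _ _ _))// ler_wpM2r ?nrm_ge0//.
  by rewrite ler_wpM2l// gerBl exprn_ge0.
have Xcvg : cvg (exp_sum b n x @[n --> \oo]).
  apply: cauchy_cvg; apply: cauchy_exP => e e0.
  have eE : e = (complex.Re e)%:C by rewrite RRe_real// gtr0_real.
  have e0R : 0 < complex.Re e by rewrite -ltcR -eE.
  have C0 : 0 < 2 * nrm x + 1 by rewrite ltr_wpDl// mulr_ge0 ?nrm_ge0.
  have [m me] := half_lt (divr_gt0 e0R C0).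
  exists (exp_sum b m x); exists m => // p /= mp.
  rewrite -ball_normE/= nrmE eE ltcR nrmB -(subnKC mp) (le_lt_trans (tail _ _))//.
  apply: (@le_lt_trans _ _ (2^-1 ^+ m * (2 * nrm x + 1))); last first.
    by rewrite -ltr_pdivlMr.
  rewrite mulrAC mulrC.
  apply: ler_pM; rewrite ?mulr_ge0 ?exprn_ge0 ?nrm_ge0 ?lerDl//.
  by apply: lerXn2r; rewrite ?nnegrE ?invr_ge0// le_half.
apply/ler_addgt0Pr => e e0.
have eC : 0 < e%:C by rewrite ltcR.
have [N _ NP] := @cvgr_dist_lt _ _ _ _ _ _ _ Xcvg _ eC.
have /NP : (N <= maxn n N)%N by exact: leq_maxr.
rewrite nrmE ltcR => le; rewrite -[X in nrm X](subrKA (exp_sum b (maxn n N) x)).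
rewrite (le_trans (nrmD _ _))// addrC lerD ?(ltW le)//.
by rewrite -(subnKC (leq_maxl n N)).
Qed.

Lemma lie_exp_geo n x :
  nrm (lie_exp b x - exp_sum b n x) <= 2 * nrm x * 2^-1 ^+ n.
Proof.
rewrite (le_trans (lie_exp_le _ _))// mulrAC ler_wpM2l ?mulr_ge0 ?nrm_ge0//.
by apply: lerXn2r; rewrite ?nnegrE ?invr_ge0// le_half.
Qed.

Lemma exp_sum_le n x : nrm (exp_sum b n x) <= 2 * nrm x.
Proof.
have := exp_sum_tail 0 n x; rewrite {2}/exp_sum big_ord0 subr0.
move=> /le_trans; apply; rewrite ler_wpM2r ?nrm_ge0// expr0.
have := exprn_ge0 n M0; lra.
Qed.

(** The quadratic remainder is what allows [ad] to be recovered from exponentials by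
    differentiation. *)
Lemma lie_exp_first x : nrm (lie_exp b x - x - lie b x) <= 2 * M ^+ 2 * nrm x.
Proof.
have := lie_exp_le 2 x; rewrite /exp_sum !big_ord_recr big_ord0/= add0r exp_term0.
by rewrite /exp_term/= invr1 scale1r opprD addrA.
Qed.

Lemma lie_exp_nrm x : nrm (lie_exp b x) <= 2 * nrm x.
Proof.
have := lie_exp_le 0 x; rewrite /exp_sum big_ord0 subr0 expr0 mulr1//.
Qed.

Lemma lie_exp_linear (a : R[i]) x y :
  lie_exp b (a *: x + y) = a *: lie_exp b x + lie_exp b y.
Proof.
apply/eqP; rewrite -subr_eq0; apply/eqP.
(* One summand for each of the three exponentials replaced by its n-th partial sum. *)
pose C := 2 * nrm (a *: x + y) + (complex.Re `|a| * (2 * nrm x) + 2 * nrm y).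
apply: (@geo_eq0 _ _ C) => n.
rewrite -[X in nrm X](subrKA (exp_sum b n (a *: x + y))).
rewrite (le_trans (nrmD _ _))// /C mulrDl lerD ?lie_exp_geo//.
rewrite exp_sum_linear nrmB opprD addrACA -scalerBr.
rewrite (le_trans (nrmD _ _))// mulrDl lerD ?lie_exp_geo//.
rewrite nrmZC -[leRHS]mulrA ler_wpM2l ?lie_exp_geo//.
by rewrite -lecR RRe_real ?normr_real ?normr_ge0.
Qed.

(** By [exp_term_lie] a partial sum for the bracket is a sum over diagonals, while the bracket of
    partial sums is a sum over a square. *)
Lemma lie_exp_lie x y : lie_exp b (lie x y) = lie (lie_exp b x) (lie_exp b y).
Proof.
apply/eqP; rewrite -subr_eq0; apply/eqP.
have [t t0 tP] := @lie_nrm R L.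
(* In order: the tail of the left-hand side, the passage from diagonals to the square, and the tails
   of the two exponentials inside the bracket, treated one at a time. *)
pose C := 2 * nrm (lie x y) + (2 * (t * nrm x * nrm y) +
  (t * (2 * nrm x) * (2 * nrm y) + t * (2 * nrm x) * (2 * nrm y))).
apply: (@geo_eq0 _ _ C) => n.
rewrite -[X in nrm X](subrKA (exp_sum b n (lie x y))).
rewrite (le_trans (nrmD _ _))// /C mulrDl lerD ?lie_exp_geo//.
rewrite -[X in nrm X](subrKA (lie (exp_sum b n x) (exp_sum b n y))).
rewrite (le_trans (nrmD _ _))// mulrDl lerD//.
  rewrite nrmB {1 2}/exp_sum lie_suml.
  under eq_bigr do rewrite lie_sumr.
  under [X in _ - X]eq_bigr do rewrite exp_term_lie.
  apply: (square_diagonal (z := fun i j => lie (exp_term b i x) (exp_term b j y))).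
    by rewrite !mulr_ge0 ?nrm_ge0// ltW.
  move=> i j; rewrite (le_trans (tP _ _))//.
  rewrite exprD [leRHS](_ : _ = t * (4^-1 ^+ i * nrm x) * (4^-1 ^+ j * nrm y)); last ring.
  have le4 k z : nrm (exp_term b k z) <= 4^-1 ^+ k * nrm z.
    rewrite (le_trans (exp_term_le _ _))// ler_wpM2r ?nrm_ge0//.
    by apply: lerXn2r; rewrite ?nnegrE ?invr_ge0.
  apply: ler_pM => //; rewrite ?mulr_ge0 ?nrm_ge0 ?(ltW t0)//.
  by rewrite ler_pM2l.
rewrite -[X in nrm X](subrKA (lie (exp_sum b n x) (lie_exp b y))).
rewrite (le_trans (nrmD _ _))// mulrDl addrC nrmB -lieBl nrmB -lieBr.
rewrite lerD// (le_trans (tP _ _))//.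
  rewrite [leRHS]mulrAC; apply: ler_pM; rewrite ?mulr_ge0 ?nrm_ge0 ?(ltW t0)//.
    by rewrite -[leRHS]mulrA ler_pM2l ?lie_exp_geo.
  exact: lie_exp_nrm.
rewrite -[leRHS]mulrA; apply: ler_pM; rewrite ?mulr_ge0 ?nrm_ge0 ?(ltW t0)//.
  by rewrite ler_pM2l ?exp_sum_le.
exact: lie_exp_geo.
Qed.

Lemma lie_exp_closed S x : closed S -> subspace S ->
  (forall y, S y -> S (lie b y)) -> S x -> S (lie_exp b x).
Proof.
move=> Sc [S0 SP] bS Sx.
apply: (closed_geo (u := fun n => exp_sum b n x) Sc _ (lie_exp_geo ^~ x)) => n.
rewrite /exp_sum; elim/big_ind: _ => // [y z Sy Sz|k _].
  by rewrite -[y]scale1r; exact: SP.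
rewrite /exp_term -[_ *: _]addr0; apply: SP => //.
by elim: (k : nat) => //= m IH; exact: bS.
Qed.

End Bounded.

(** The bound 1/4 gives terms of size 4^-k, so that the at most n^2 terms between square and
    triangle still sum to order 2^-n. *)
Definition lie_small b :=
  exists2 M : R, 0 <= M <= 4^-1 & forall x, nrm (lie b x) <= M * nrm x.

Lemma lie_smallN b : lie_small b -> lie_small (- b).
Proof. by move=> [M M04 bM]; exists M => // x; rewrite lieNl nrmN. Qed.

(** The product of partial sums of exp(b) and exp(-b) is a sum over a square; summed over diagonals
    it collapses to [x] by [exp_term_inv]. *)
Lemma lie_expK b : lie_small b -> cancel (lie_exp (- b)) (lie_exp b).
Proof.
move=> [M /andP[M0 M4] bM] x.
have bN y : nrm (lie (- b) y) <= M * nrm y by rewrite lieNl nrmN.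
apply/eqP; rewrite -subr_eq0; apply/eqP.
pose y := lie_exp (- b) x.
pose C := 2 * nrm y + (2 * (2 * nrm x) + 4 * nrm x).
apply: (@geo_eq0 _ _ C) => n.
(* With n+1 terms the diagonal of degree 0, the only one that does not vanish, is always
   included. *)
rewrite -[X in nrm X](subrKA (exp_sum b n.+1 y)).
have le2 : 2^-1 ^+ n.+1 <= 2^-1 ^+ n :> R.
  by rewrite ler_wiXn2l ?invr_ge0 ?invf_le1 ?ler1n.
rewrite (le_trans (nrmD _ _))// /C mulrDl lerD//.
  rewrite (le_trans (lie_exp_geo bM M0 M4 _ _))// ler_wpM2l// mulr_ge0 ?nrm_ge0//.
rewrite -[X in nrm X](subrKA (exp_sum b n.+1 (exp_sum (- b) n.+1 x))).
rewrite (le_trans (nrmD _ _))// mulrDl lerD//.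
  rewrite -exp_sumB (le_trans (exp_sum_le bM M0 M4 _ _))// -mulrA ler_pM2l//.
  by rewrite (le_trans (lie_exp_geo bN M0 M4 _ _))// ler_wpM2l// mulr_ge0 ?nrm_ge0.
have := @square_diagonal _ _ (fun i j => exp_term b i (exp_term (- b) j x))
  (nrm x) n.+1 (nrm_ge0 x).
have -> : \sum_(k < n.+1) \sum_(i < k.+1)
    exp_term b i (exp_term (- b) (k - i) x) = x.
  under eq_bigr do rewrite exp_term_inv.
  by rewrite big_ord_recl/= big1 ?addr0.
under eq_bigr do rewrite -exp_term_sum.
rewrite -/(exp_sum _ _ _) => /(_ _)/le_trans; apply.
  move=> i j; rewrite (le_trans (exp_term_le bM M0 _ _))// exprD.
  have le4 k : M ^+ k <= 4^-1 ^+ k by apply: lerXn2r; rewrite ?nnegrE ?invr_ge0.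
  rewrite mulrCA; apply: ler_pM; rewrite ?nrm_ge0 ?exprn_ge0//.
  rewrite (le_trans (exp_term_le bN M0 _ _))// [leLHS]mulrC ler_wpM2l ?nrm_ge0//.
rewrite ler_pM ?mulr_ge0 ?nrm_ge0 ?exprn_ge0 ?invr_ge0//.
by rewrite ler_wpM2r ?nrm_ge0 ?ler_nat.
Qed.

(** The difference quotients of exp(ad(s a)) x at s = 0 lie in [S] and approximate [a, x]. *)
Lemma lie_exp_invariant_ideal S a x : closed S -> subspace S ->
  (forall b y, lie_small b -> S y -> S (lie_exp b y)) -> S x -> S (lie a x).
Proof.
move=> Sc [S0 SP] Sexp Sx; have [t t0 tP] := @lie_nrm R L.
apply: closed_nrm => // e e0.
pose A := t * nrm a; have A0 : 0 <= A by rewrite mulr_ge0 ?nrm_ge0 ?ltW.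
pose B := 2 * A ^+ 2 * nrm x / e.
have B0 : 0 <= B.
  by rewrite divr_ge0 ?(ltW e0)// mulr_ge0 ?nrm_ge0// mulr_ge0 ?exprn_ge0.
(* s A <= 1/4 makes [s a] small, and s B < 1 keeps the remainder of the difference quotient, which
   is at most s B e, below e. *)
pose s := (4 * A + 1 + B)^-1.
have s0 : 0 < s by rewrite invr_gt0; lra.
have sA : s * A <= 4^-1.
  by rewrite mulrC ler_pdivrMr; lra.
have sB : s * B < 1 by rewrite mulrC ltr_pdivrMr; lra.
pose b := s%:C *: a.
have bM y : nrm (lie b y) <= s * A * nrm y.
  by rewrite lieZl nrmZ (gtr0_norm s0) -mulrA ler_pM2l.
have sA0 : 0 <= s * A by rewrite mulr_ge0 ?(ltW s0).
have Sb : S (lie_exp b x).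
  by apply: Sexp => //; exists (s * A); rewrite ?sA0.
exists ((s^-1)%:C *: (lie_exp b x - x)).
  rewrite -[_ *: _]addr0; apply: (SP) => //; rewrite addrC -scaleN1r; exact: SP.
have -> : lie a x = (s^-1)%:C *: lie b x.
  by rewrite lieZl scalerA -rmorphM/= mulVf ?gt_eqF// scale1r.
have si0 : 0 < s^-1 by rewrite invr_gt0.
rewrite -scalerBr nrmZ (gtr0_norm si0) nrmB.
rewrite (le_lt_trans (ler_wpM2l _ (lie_exp_first bM sA0 sA x))) ?(ltW si0)//.
have -> : s^-1 * (2 * (s * A) ^+ 2 * nrm x) = s * B * e.
  by rewrite /B; field; rewrite !gt_eqF.
by rewrite gtr_pMl.
Qed.

End Exponential.

(** * Closures and Lie subideals *)

Lemma closure_sub (T : topologicalType) (A B : set T) :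
  closed B -> A `<=` B -> closure A `<=` B.
Proof. by move=> Bc AB; rewrite (closure_id B).1//; exact: closureS. Qed.

Section BoundedMaps.
Context {R : realType} {L M : normedModType R[i]}.

(** Additivity and a linear bound give Lipschitz continuity; brackets with a fixed element,
    exponentials and quotient maps are all of this form. *)
Definition bounded_map (f : L -> M) :=
  {morph f : x y / x - y} /\ exists K : R, forall x, nrm (f x) <= K * nrm x.

Lemma closed_bounded_preimage (f : L -> M) (T : set M) :
  bounded_map f -> closed T -> closed (f @^-1` T).
Proof.
move=> [fB [K fK]] Tc x /closure_nrmP Tx; apply: (closed_nrm Tc) => e e0.
have K1 : 0 < `|K| + 1 by rewrite ltr_wpDl.
have [y Ty xy] := Tx _ (divr_gt0 e0 K1).
exists (f y) => //; rewrite -fB (le_lt_trans (fK _))//.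
apply: (@le_lt_trans _ _ ((`|K| + 1) * nrm (x - y))).
  by rewrite ler_wpM2r ?nrm_ge0// (le_trans (ler_norm _))// lerDl.
by rewrite mulrC -ltr_pdivlMr.
Qed.

Lemma closure_bounded_image (f : L -> M) (A : set L) (B : set M) :
  bounded_map f -> (forall x, A x -> B (f x)) ->
  forall x, closure A x -> closure B (f x).
Proof.
move=> fb AB; apply: (closure_sub (B := f @^-1` closure B)).
  exact: closed_bounded_preimage fb (@closed_closure _ _).
by move=> x /AB; exact: subset_closure.
Qed.

End BoundedMaps.

Section Subspaces.
Context {R : realType} {L : banachLieType R}.
Implicit Types (A B C I J S T : set L).

Lemma subspaceN S x : subspace S -> S x -> S (- x).
Proof. by move=> [S0 SP] Sx; rewrite -[- x]addr0 -scaleN1r; exact: SP. Qed.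

Lemma subspaceD S x y : subspace S -> S x -> S y -> S (x + y).
Proof. by move=> [S0 SP] Sx Sy; rewrite -[x]scale1r; exact: SP. Qed.

Lemma subspaceB S x y : subspace S -> S x -> S y -> S (x - y).
Proof. by move=> Ss Sx Sy; apply: subspaceD => //; exact: subspaceN. Qed.

Lemma subspaceI S T : subspace S -> subspace T -> subspace (S `&` T).
Proof.
move=> [S0 SP] [T0 TP]; split=> // a x y [Sx Tx] [Sy Ty].
by split; [exact: SP|exact: TP].
Qed.

Lemma subspace_bigcap (F : set (set L)) :
  (forall S, F S -> subspace S) -> subspace (\bigcap_(S in F) S).
Proof.
move=> Fs; split=> [S /Fs[]//|a x y Fx Fy S FS].
by have [_] := Fs S FS; apply; [exact: Fx|exact: Fy].
Qed.

Lemma bounded_map_liel z : bounded_map (fun x : L => lie x z).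
Proof.
split=> [x y|]; first exact: lieBl.
have [t _ tP] := @lie_nrm R L; exists (t * nrm z) => x.
by rewrite mulrAC.
Qed.

Lemma bounded_map_lier z : bounded_map (fun x : L => lie z x).
Proof.
by split=> [x y|]; [exact: lieBr|have [t _ tP] := @lie_nrm R L; exists (t * nrm z)].
Qed.

(** Separate continuity, one variable at a time; the second passage stays in [closure C], which is
    already closed. *)
Lemma closure_lie A B C : (forall x y, A x -> B y -> C (lie x y)) ->
  forall x y, closure A x -> closure B y -> closure C (lie x y).
Proof.
move=> ABC x y Ax By.
have {}ABC z : B z -> closure C (lie x z).
  move=> Bz; apply: closure_bounded_image (bounded_map_liel z) _ _ Ax => w Aw.
  exact: ABC.
have := closure_bounded_image (bounded_map_lier x) ABC By.
by rewrite -(closure_id (closure C)).1//; exact: closed_closure.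
Qed.

Lemma subspace_closure S : subspace S -> subspace (closure S).
Proof.
move=> Ss; have [S0 SP] := Ss; split=> [|a x y]; first exact: subset_closure.
move=> /closure_nrmP Sx /closure_nrmP Sy; apply/closure_nrmP => e e0.
pose r : R := complex.Re `|a|.
have r0 : 0 <= r by rewrite -lecR RRe_real ?normr_real ?normr_ge0.
have e2 : 0 < e / 2 by rewrite divr_gt0.
have r1 : 0 < r + 1 by rewrite ltr_wpDl.
have [x' Sx' xx'] := Sx _ (divr_gt0 e2 r1).
have [y' Sy' yy'] := Sy _ e2.
exists (a *: x' + y'); first exact: SP.
rewrite opprD addrACA -scalerBr (le_lt_trans (nrmD _ _))// nrmZC -/r [e]splitr.
rewrite ler_ltD// (@le_trans _ _ ((r + 1) * nrm (x - x')))//.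
  by rewrite ler_wpM2r ?nrm_ge0// lerDl.
by rewrite mulrC -ler_pdivlMr// ltW.
Qed.

Lemma closed_span_closed S : closed (closed_span S).
Proof. exact: closed_closure. Qed.

Lemma closed_span_subspace S : subspace (closed_span S).
Proof. by apply: subspace_closure; apply: subspace_bigcap => T []. Qed.

Lemma sub_closed_span S : S `<=` closed_span S.
Proof. by apply: subset_trans (@subset_closure _ _) => x Sx T [_]; apply. Qed.

Lemma closed_span_sub S T :
  closed T -> subspace T -> S `<=` T -> closed_span S `<=` T.
Proof.
by move=> Tc Ts ST; apply: closure_sub => // x; apply.
Qed.

Lemma closed_spanS S T : S `<=` T -> closed_span S `<=` closed_span T.
Proof.
move=> ST; apply: closed_span_sub => //; first exact: closed_span_closed.
- exact: closed_span_subspace.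
- exact: subset_trans ST (@sub_closed_span _).
Qed.

Lemma lie_subalgebraT : lie_subalgebra [set: L]. Proof. by []. Qed.

Lemma lie_ideal_refl A : lie_subalgebra A -> lie_ideal A A.
Proof. by move=> [As AP]; split. Qed.

Lemma lie_ideal_subalgebra A I : lie_ideal A I -> lie_subalgebra I.
Proof. by move=> [Is IA IP]; split=> // x y /IA + Iy; move=> /IP; apply. Qed.

Lemma lie_subideal_subalgebra A I : lie_subideal A I -> lie_subalgebra I.
Proof. by move=> [n [J [<- _ Ja _]]]; exact: Ja. Qed.

Lemma lie_subideal_sub A I : lie_subideal A I -> I `<=` A.
Proof.
move=> [n [J [<- <- _ Ji]]].
elim: n Ji => [|n IH] Ji //; have [_ JS _] := Ji n (leqnn _).
by apply: subset_trans JS; apply: IH => i /ltnW; exact: Ji.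
Qed.

Lemma lie_subideal_ideal A B I :
  lie_subideal A B -> lie_ideal B I -> lie_subideal A I.
Proof.
move=> [n [J [J0 Jn Ja Ji]]] BI.
exists n.+1, (fun i => if i is i'.+1 then J i' else I); split=> //.
- by case=> [_|i]; [exact: lie_ideal_subalgebra BI|rewrite ltnS; exact: Ja].
- by case=> [_|i]; [rewrite J0|rewrite ltnS; exact: Ji].
Qed.

(** Intersect every member of the chain with [P]. *)
Lemma lie_subideal_restrict P A :
  lie_ideal [set: L] P -> lie_subideal [set: L] A -> A `<=` P -> lie_subideal P A.
Proof.
move=> Pi [n [J [J0 Jn Ja Ji]]] AP; have [Ps _ PP] := Pi.
exists n, (fun i => J i `&` P); split.
- by rewrite J0; apply: setIidl.
- by rewrite Jn setTI.
- move=> i /Ja[Js JP]; split; first exact: subspaceI.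
  by move=> x y [Jx Px] [Jy Py]; split; [exact: JP|exact: PP].
- move=> i lin; have [Js JS JP] := Ji i lin; split; first exact: subspaceI.
    by move=> x [Jx Px]; split=> //; exact: JS.
  by move=> a x [Ja' Pa] [Jx Px]; split; [exact: JP|exact: PP].
Qed.

Lemma lie_subideal_closure A I :
  lie_subideal A I -> lie_subideal (closure A) (closure I).
Proof.
move=> [n [J [<- <- Ja Ji]]]; exists n, (fun i => closure (J i)); split=> //.
- by move=> i /Ja[Js JP]; split; [exact: subspace_closure|exact: closure_lie].
- move=> i /Ji[Js JS JP]; split; [exact: subspace_closure|exact: closureS|].
  exact: closure_lie.
Qed.

Lemma commutative_closure A : commutative_set A -> commutative_set (closure A).
Proof.
move=> Ac x y Ax Ay.
have : closure [set 0 : L] (lie x y) by apply: closure_lie Ax Ay => ? ? *; exact: Ac.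
by rewrite -(closure_id _).1//; apply: accessible_closed_set1; exact: hausdorff_accessible.
Qed.

End Subspaces.

(** * Transport of ideals and subideals along Lie homomorphisms *)

Section Homomorphisms.
Context {R : realType} {L M : banachLieType R} (f : L -> M).

Definition lie_hom :=
  (forall a x y, f (a *: x + y) = a *: f x + f y) /\
  forall x y, f (lie x y) = lie (f x) (f y).

Hypothesis fh : lie_hom.

Lemma lie_hom0 : f 0 = 0.
Proof.
by have := fh.1 1 0 0; rewrite !scale1r addr0 => /esym/(canRL (addrK _)); rewrite subrr.
Qed.

Lemma lie_homB x y : f (x - y) = f x - f y.
Proof. by rewrite addrC -scaleN1r fh.1 scaleN1r addrC. Qed.

Lemma subspace_preimage S : subspace S -> subspace (f @^-1` S).
Proof.
move=> [S0 SP]; split=> [|a x y Sx Sy]; first by rewrite /preimage/= lie_hom0.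
by rewrite /preimage/= fh.1; exact: SP.
Qed.

Lemma lie_ideal_preimage A I : lie_ideal A I -> lie_ideal (f @^-1` A) (f @^-1` I).
Proof.
move=> [Is IA IP]; split; [exact: subspace_preimage|by move=> x /IA|].
by move=> a x Aa Ix; rewrite /preimage/= fh.2; exact: IP.
Qed.

Lemma lie_subideal_preimage A I :
  lie_subideal A I -> lie_subideal (f @^-1` A) (f @^-1` I).
Proof.
move=> [n [J [<- <- Ja Ji]]]; exists n, (fun i => f @^-1` J i); split=> //.
  move=> i /Ja[Js JP]; split; first exact: subspace_preimage.
  by move=> x y Jx Jy; rewrite /preimage/= fh.2; exact: JP.
by move=> i /Ji; exact: lie_ideal_preimage.
Qed.

Lemma subspace_image S : subspace S -> subspace (f @` S).
Proof.
move=> [S0 SP]; split; first by exists 0 => //; exact: lie_hom0.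
by move=> a _ _ [x Sx <-] [y Sy <-]; exists (a *: x + y); [exact: SP|exact: fh.1].
Qed.

Lemma lie_ideal_image A I : lie_ideal A I -> lie_ideal (f @` A) (f @` I).
Proof.
move=> [Is IA IP]; split; [exact: subspace_image|exact: image_subset|].
by move=> _ _ [a Aa <-] [x Ix <-]; exists (lie a x); [exact: IP|exact: fh.2].
Qed.

Lemma lie_subideal_image A I :
  lie_subideal A I -> lie_subideal (f @` A) (f @` I).
Proof.
move=> [n [J [<- <- Ja Ji]]]; exists n, (fun i => f @` J i); split=> //.
  move=> i /Ja[Js JP]; split; first exact: subspace_image.
  by move=> _ _ [x Jx <-] [y Jy <-]; exists (lie x y); [exact: JP|exact: fh.2].
by move=> i /Ji; exact: lie_ideal_image.
Qed.

End Homomorphisms.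

(** * Primitive ideals and commutative subideals *)

Section Automorphisms.
Context {R : realType} {L : banachLieType R} (b : L).
Hypothesis bs : lie_small b.

Lemma lie_hom_exp : lie_hom (lie_exp b).
Proof.
have [M /andP[M0 M4] bM] := bs.
by split; [exact: (lie_exp_linear bM)|exact: (lie_exp_lie bM)].
Qed.

Lemma bounded_map_exp : bounded_map (lie_exp b).
Proof.
have [M /andP[M0 M4] bM] := bs; split; first exact: lie_homB lie_hom_exp.
by exists 2; exact: (lie_exp_nrm bM).
Qed.

Lemma lie_ideal_exp P x :
  closed P -> lie_ideal [set: L] P -> P x -> P (lie_exp b x).
Proof.
have [M /andP[M0 M4] bM] := bs; move=> Pc [Ps _ PP].
by apply: (lie_exp_closed bM) => // y; exact: PP.
Qed.

Lemma lie_expNK : cancel (lie_exp b) (lie_exp (- b)).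
Proof. by have := lie_expK (lie_smallN bs); rewrite opprK. Qed.

End Automorphisms.

(** A closed ideal is invariant under both exp(b) and its inverse exp(-b). *)
Lemma exp_preimage_ideal {R : realType} {L : banachLieType R} (b : L) P :
  lie_small b -> closed P -> lie_ideal [set: L] P -> lie_exp b @^-1` P = P.
Proof.
move=> bs Pc Pi; apply/seteqP; split=> x; last exact: lie_ideal_exp.
move=> Px; rewrite -[x](lie_expNK bs).
exact: (lie_ideal_exp (lie_smallN bs) (P := P)) Px.
Qed.

Section Primitive.
Context {R : realType} {L : banachLieType R}.
Implicit Types (A I J P : set L).

Lemma PV_sub_primitive A J : primitive_ideal A J -> PV A `<=` J.
Proof. by move=> AJ x; apply. Qed.

Lemma PV_primitive A :
  closed A -> lie_subalgebra A -> primitive_ideal A (PV A).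
Proof.
move=> Ac Aa.
(* This makes the intersected family nonempty and places [PV A] inside [A]. *)
have AA : primitive_ideal A A.
  by split; [|exact: lie_ideal_refl|move=> I /lie_subideal_sub].
split.
- by apply: closed_bigI => J [].
- split; first by apply: subspace_bigcap => J [_ []].
    exact: PV_sub_primitive.
  move=> a x Aa' Qx J AJ; have [_ [_ _ JP] _] := AJ; apply: JP => //.
  exact: Qx.
- move=> I AI IQ x Ix J AJ; have [_ _ JP] := AJ; apply: JP Ix => // y z Iy Iz.
  exact: IQ.
Qed.

(** exp(b) restricts to an automorphism of [P], and automorphisms pull primitive ideals back to
    primitive ideals. *)
Lemma primitive_exp P J b : closed P -> lie_ideal [set: L] P ->
  lie_small b -> primitive_ideal P J -> primitive_ideal P (lie_exp b @^-1` J).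
Proof.
move=> Pc Pi bs [Jc Ji JP]; have bh := lie_hom_exp bs; split.
- exact: closed_bounded_preimage (bounded_map_exp bs) Jc.
- by rewrite -(exp_preimage_ideal bs Pc Pi); exact: lie_ideal_preimage.
- move=> I PI IJ x Ix.
  have bsN := lie_smallN bs.
  (* Primitivity of [J] is tested on the image of [I] under exp(b), written as a preimage under
     exp(-b). *)
  apply: (JP (lie_exp (- b) @^-1` I)) => [|y z Iy Iz|].
  + rewrite -(exp_preimage_ideal bsN Pc Pi).
    exact: lie_subideal_preimage (lie_hom_exp bsN) _ _ PI.
  + have := IJ _ _ Iy Iz; rewrite /preimage/= bh.2.
    by rewrite !lie_expK.
  + by rewrite /preimage/= lie_expNK.
Qed.

Lemma PV_ideal P : closed P -> lie_ideal [set: L] P ->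
  lie_ideal [set: L] (PV P).
Proof.
move=> Pc Pi; have Pa := lie_ideal_subalgebra Pi.
have [Qc [Qs _ _] _] := PV_primitive Pc Pa.
split=> // a x _ Qx; apply: lie_exp_invariant_ideal Qx => // b y bs Qy J PJ.
exact: Qy (primitive_exp Pc Pi bs PJ).
Qed.

Lemma PV_idem : PV (PV [set: L]) = PV [set: L].
Proof.
set P := PV setT.
have PT : primitive_ideal setT P by exact: PV_primitive closedT lie_subalgebraT.
have [Pc Pi PP] := PT; have Pa := lie_ideal_subalgebra Pi.
have [Qc QPi QP] := PV_primitive Pc Pa; have [_ QsubP _] := QPi.
apply/seteqP; split=> //; apply: PV_sub_primitive; split=> //.
  exact: PV_ideal.
(* As [I, I] lies in Q and so in P, primitivity of P puts I inside P; there I is a subideal, and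
   primitivity of Q in P applies. *)
move=> I TI IQ; apply: QP => //; apply: lie_subideal_restrict => //.
by apply: PP => // x y Ix Iy; apply: QsubP; exact: IQ.
Qed.

End Primitive.

(** * The radical spanned by commutative subideals *)

Section AbelianSubideals.
Context {R : realType} {L : banachLieType R}.
Implicit Types (A I J P : set L).

Definition abelian_subideals : set L := \bigcup_(A in [set A |
  lie_subideal [set: L] A /\ commutative_set A]) A.

Lemma SAbel_commutative A : closed A -> lie_subalgebra A ->
  commutative_set A -> SAbel A = A.
Proof.
move=> Ac Aa Acomm; apply/seteqP; split.
  by apply: closed_span_sub => //; [exact: Aa.1|move=> x [I [_ [_ IA _] _] /IA]].
apply: subset_trans (@sub_closed_span _ _ _) => x Ax.
by exists A => //; split=> //; exact: lie_ideal_refl.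
Qed.

(** A subideal equal to its own [SAbel] is spanned by commutative ideals of it, which are subideals
    of [L]. Conversely, the closure of a commutative subideal is a commutative subideal, hence equal
    to its own [SAbel]. *)
Lemma SAbel_sE : SAbel_s [set: L] = closed_span abelian_subideals.
Proof.
apply/seteqP; split.
  apply: closed_span_sub; [exact: closed_span_closed|exact: closed_span_subspace|].
  move=> x [C [Cc TC CE] Cx]; move: Cx; rewrite -CE.
  apply: closed_spanS => y [B [Bc CB Bcomm] By].
  by exists B => //; split=> //; exact: lie_subideal_ideal CB.
apply: closed_spanS => x [A [TA Acomm] Ax].
exists (closure A); last exact: subset_closure.
have TcA : lie_subideal [set: L] (closure A).
  by rewrite -closureT; exact: lie_subideal_closure.
split=> //; first exact: closed_closure.
apply: SAbel_commutative; first exact: closed_closure.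
  exact: lie_subideal_subalgebra TcA.
exact: commutative_closure.
Qed.

Lemma SAbel_s_exp b x : lie_small b ->
  SAbel_s [set: L] x -> SAbel_s [set: L] (lie_exp b x).
Proof.
move=> bs; rewrite SAbel_sE => Sx.
have bh := lie_hom_exp bs; have bsN := lie_smallN bs.
have bhN := lie_hom_exp bsN.
suff /(_ x Sx) : closed_span abelian_subideals `<=`
  lie_exp b @^-1` closed_span abelian_subideals by [].
apply: closed_span_sub.
- exact: closed_bounded_preimage (bounded_map_exp bs) (@closed_span_closed _ _ _).
- apply: subspace_preimage => //; exact: closed_span_subspace.
move=> y [A [TA Ac] Ay]; apply: sub_closed_span.
(* The image of [A] under the automorphism exp(b) is again a commutative subideal. *)
exists (lie_exp (- b) @^-1` A); last by rewrite /preimage/= lie_expNK.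
split; first exact: lie_subideal_preimage bhN _ _ TA.
move=> z w Az Aw; have := Ac _ _ Az Aw; rewrite -bhN.2 => /(congr1 (lie_exp b)).
by rewrite lie_expK// (lie_hom0 bh).
Qed.

Lemma SAbel_s_ideal : lie_ideal [set: L] (SAbel_s [set: L]).
Proof.
split=> //; first exact: closed_span_subspace.
move=> a x _; apply: lie_exp_invariant_ideal.
- exact: closed_span_closed.
- exact: closed_span_subspace.
- by move=> b y bs; exact: SAbel_s_exp.
Qed.

End AbelianSubideals.

(** * Radicals of quotients and primitive ideals *)

Section QuotientRadical.
Context {R : realType} {L : banachLieType R}.
Implicit Types (K : closedIdeal L) (J : set L).
Local Notation quot_rad := (quot_rad (@SAbel_s R)).

Lemma qmap_hom K : lie_hom (@qmap R L K).
Proof. by split=> [a x y|x y]; [rewrite qmapD qmapZ|exact: qmap_lie]. Qed.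

Lemma qmap_bounded K : bounded_map (@qmap R L K).
Proof.
split=> [x y|]; first exact: qmapB.
by exists 1 => x; rewrite mul1r -lecR -!nrmE qmap_norm_le.
Qed.

Lemma qmap_eq0 K x : qmap K x = 0 <-> closedIdeal_set K x.
Proof. by rewrite -[in X in _ <-> X](subr0 x) -qmap_eqP qmap0. Qed.

Lemma qmap_image_setT K : @qmap R L K @` [set: L] = [set: lquot K].
Proof. by apply/seteqP; split=> // q _; have [x <-] := qmap_surj q; exists x. Qed.

Lemma quot_rad_closed K : closed (quot_rad K).
Proof.
exact: closed_bounded_preimage (qmap_bounded K) (@closed_span_closed _ _ _).
Qed.

Lemma quot_rad_ideal K : lie_ideal [set: L] (quot_rad K).
Proof. exact: (lie_ideal_preimage (qmap_hom K) SAbel_s_ideal). Qed.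

Lemma sub_quot_rad K : K `<=` quot_rad K.
Proof.
move=> x /qmap_eq0 Kx; rewrite /Defs.quot_rad/= Kx.
exact: (closed_span_subspace _).1.
Qed.

(** If [A, A] lies in [K], the image of [A] in the quotient is a commutative subideal and so lies in
    the radical there. *)
Lemma quot_rad_fixed_primitive K :
  quot_rad K = K -> primitive_ideal [set: L] K.
Proof.
move=> KE; split; [exact: closedIdeal_closed|exact: closedIdeal_ideal|].
move=> A TA AK x Ax; rewrite -KE /Defs.quot_rad/= SAbel_sE.
apply: sub_closed_span; exists (@qmap R L K @` A); last by exists x.
split.
  by rewrite -(qmap_image_setT K); exact: lie_subideal_image (qmap_hom K) _ _ TA.
by move=> _ _ [y Ay <-] [z Az <-]; rewrite -qmap_lie; apply/qmap_eq0; exact: AK.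
Qed.

(** The preimage of a commutative subideal of the quotient has its brackets in [K], hence in [J], so
    primitivity puts it inside [J]. *)
Lemma quot_rad_sub_primitive K J :
  primitive_ideal [set: L] J -> K `<=` J -> quot_rad K `<=` J.
Proof.
move=> [Jc Ji JP] KJ; have [Js _ _] := Ji.
have qJ x : (@qmap R L K @` J) (qmap K x) -> J x.
  move=> [y Jy /qmap_eqP/KJ yx].
  by rewrite -[x](subKr y); apply: subspaceB.
suff SJ : SAbel_s [set: lquot K] `<=` @qmap R L K @` J by move=> x /SJ; exact: qJ.
rewrite SAbel_sE; apply: closed_span_sub.
(* The image of [J] is closed: a small difference of classes lifts to a small z, and x - z lies in
   [J] because [J] contains [K]. *)
- move=> q; have [x <-] := qmap_surj q => /closure_nrmP qx; exists x => //.
  apply: (closed_nrm Jc) => e e0; have [_ [y Jy <-]] := qx e e0.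
  rewrite -qmapB -ltcR -nrmE => /qmap_lift[z zxy ze].
  exists (x - z); last by rewrite subKr -ltcR -nrmE.
  by apply: qJ; exists y => //; rewrite qmapB zxy qmapB subKr.
- exact: subspace_image (qmap_hom K) _ Js.
move=> q [B [TB Bc] Bq]; have [x xq] := qmap_surj q; exists x => //.
apply: (JP (@qmap R L K @^-1` B)); last by rewrite /preimage/= xq.
  exact: lie_subideal_preimage (qmap_hom K) _ _ TB.
by move=> y z By Bz; apply: KJ; apply/qmap_eq0; rewrite qmap_lie; exact: Bc.
Qed.

End QuotientRadical.

(** * Transfinite chains *)

Section WellOrders.
Context {W : eqType} (le : rel W).
Hypothesis wo : well_order le.
Local Notation lt := (olt le).

Lemma wo_total : total le.
Proof.
move=> x y; have [|z [[/orP[]/eqP-> zmin] _]] := wo (A := [pred z | (z == x) || (z == y)]).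
- by exists x; rewrite inE eqxx.
- by rewrite zmin// inE eqxx orbT.
- by rewrite [le y x]zmin ?orbT// inE eqxx.
Qed.

Lemma wo_refl x : le x x.
Proof. by have := wo_total x x; rewrite orbb. Qed.

(** Both elements are minima of the pair, and the minimum is unique. *)
Lemma wo_anti x y : le x y -> le y x -> x = y.
Proof.
move=> xy yx; have [|z [_ zu]] := wo (A := [pred z | (z == x) || (z == y)]).
  by exists x; rewrite inE eqxx.
rewrite -(zu x); last first.
  by split=> [|u /orP[]/eqP->]; rewrite ?inE ?eqxx ?wo_refl.
apply: zu; split=> [|u /orP[]/eqP->]; rewrite ?inE ?eqxx ?orbT ?wo_refl//.
Qed.

Lemma olt_le v w : lt v w -> le v w. Proof. by case/andP. Qed.

Lemma nle_olt v w : ~~ le w v -> lt v w.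
Proof.
move=> wv; rewrite /olt; have := wo_total v w; rewrite (negPf wv) orbF => ->.
by rewrite andbT; apply: contraNneq wv => ->; exact: wo_refl.
Qed.

Lemma olt_nle v w : lt v w -> ~~ le w v.
Proof.
move=> /andP[vw le_vw]; apply: contraNN vw => le_wv.
by apply/eqP; exact: wo_anti.
Qed.

Lemma wo_ind (Q : W -> Prop) :
  (forall w, (forall v, lt v w -> Q v) -> Q w) -> forall w, Q w.
Proof.
move=> IH w; apply: contrapT => Qw.
have /wo[m [[/asboolP Qm mmin] _]] : nonempty [pred w | `[< ~ Q w >]].
  by exists w; apply/asboolP.
apply: Qm; apply: IH => v vm; apply: contrapT => Qv.
by have /negP := olt_nle vm; apply; apply: mmin; apply/asboolP.
Qed.

Lemma wo_wf : well_founded lt.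
Proof. by apply: wo_ind => w IH; constructor. Qed.

Variant wo_spec w : Prop :=
  | WoZero of ozero le w
  | WoSucc v of osucc le v w
  | WoLimit of olimit le w.

Lemma woP w : wo_spec w.
Proof.
have [|w0] := pselect (ozero le w); first exact: WoZero.
have [[v vw]|ws] := pselect (exists v, osucc le v w); first exact: WoSucc vw.
exact: WoLimit.
Qed.

Lemma olimit_between w v : olimit le w -> lt v w -> exists2 u, lt v u & lt u w.
Proof.
move=> [_ ws] vw; apply: contrapT => nu; apply: ws; exists v; split=> // u vu.
by apply: contrapT => /negP/nle_olt uw; apply: nu; exists u.
Qed.

(** An element strictly between some v < w and w cannot be least. It supplies a stage below the
    limit where the chain has already started to move. *)
Lemma olimit_gt_nonzero w : olimit le w -> exists2 u, lt u w & ~ ozero le u.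
Proof.
move=> wl; have [w0 _] := wl.
have [v vw] : exists v, lt v w.
  apply: contrapT => nv; apply: w0 => v; apply: contrapT => /negP/nle_olt vw.
  by apply: nv; exists v.
have [u vu uw] := olimit_between wl vw; exists u => // u0.
by have /negP := olt_nle vu; apply.
Qed.

End WellOrders.

(** * The decreasing chain *)

Section LowerChain.
Context {R : realType} {L : banachLieType R}.
Local Notation P := (PV [set: L]).

Lemma PV_T : primitive_ideal [set: L] P.
Proof. exact: PV_primitive closedT lie_subalgebraT. Qed.

(** The first step reaches [P], idempotence keeps later successors there, and the intersection at a
    limit runs over some nonzero stage. *)
Lemma lower_chain_PV (W : eqType) (le : rel W) (c : W -> set L) w :
  well_order le -> lower_chain (@PV R) le c -> ~ ozero le w -> c w = P.
Proof.
move=> wo [c0 cS cl]; elim/(wo_ind wo): w => w IH w0.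
have [//|v vw|wl] := woP le w.
  rewrite (cS _ _ vw); have [v0|v0] := pselect (ozero le v); first by rewrite c0.
  by rewrite IH ?PV_idem//; exact: vw.1.
rewrite cl//; apply/seteqP; split=> [x|x Px v vw].
  have [u uw u0] := olimit_gt_nonzero wo wl.
  by move=> /(_ u uw); rewrite IH.
have [v0|v0] := pselect (ozero le v); first by rewrite c0.
by rewrite IH.
Qed.

Lemma rad_circ_PV : rad_circ (@PV R) L = P.
Proof.
apply/seteqP; split=> [x [W [le [c [w [wo cP cw]]]]]|x Px].
  (* At the zero stage, stabilization itself says that [P] is all of [L]. *)
  have [w0|w0] := pselect (ozero le w); last by rewrite (lower_chain_PV wo cP).
  by have [c0 _ _] := cP; rewrite -cw c0.
(* [implb] orders the booleans by [false] < [true]: a chain of length two, with no limit stage. *)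
exists bool, implb, (fun w => if w then P else setT), true.
split=> //; last exact: PV_idem.
- apply: antisymmetric_well_order => [[] []//|A].
  have [Af _|Af [[] At]] := boolP (false \in A).
  + by exists false; split=> // -[].
  + by exists true; split=> // -[]// /(negP Af).
  + by rewrite At in Af.
- split.
  + by case=> // /(_ false).
  + by case=> -[] [] // _ /(_ _ _).
  + by case=> -[w0 ws]; exfalso; [apply: ws; exists false; split=> // -[]|apply: w0].
Qed.

End LowerChain.

(** * The increasing chain *)

Section UpperChain.
Context {R : realType} {L : banachLieType R}.
Implicit Types (K : closedIdeal L) (U : set L).
Local Notation P := (PV [set: L]).
Local Notation quot_rad := (quot_rad (@SAbel_s R)).

Lemma upper_chain_sub (W : eqType) (le : rel W) (c : W -> closedIdeal L) w :
  well_order le -> upper_chain (@SAbel_s R) le c -> c w `<=` P.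
Proof.
move=> wo [c0 cS cl]; have [Pc [Ps _ _] _] := @PV_T R L.
elim/(wo_ind wo): w => w IH; have [w0|v vw|wl] := woP le w.
- by rewrite c0// => _ ->; exact: Ps.1.
- rewrite (cS _ _ vw); apply: quot_rad_sub_primitive; first exact: PV_T.
  by apply: IH; exact: vw.1.
- by rewrite cl//; apply: closure_sub => // x [v /IH]; exact.
Qed.

(** The smallest closed ideal containing [U]; it lets the recursion produce a closed ideal at every
    stage before monotonicity is known. *)
Definition ideal_span U : set L :=
  \bigcap_(J in [set J | [/\ closed J, lie_ideal [set: L] J & U `<=` J]]) J.

Lemma ideal_span_closed U : closed (ideal_span U).
Proof. by apply: closed_bigI => J []. Qed.

Lemma ideal_span_ideal U : lie_ideal [set: L] (ideal_span U).
Proof.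
split=> //; first by apply: subspace_bigcap => J [_ []].
move=> a x _ Ux J [Jc Ji UJ]; have [_ _] := Ji; apply=> //.
exact: Ux.
Qed.

Definition ideal_span_cideal U : closedIdeal L :=
  ClosedIdeal (@ideal_span_closed U) (ideal_span_ideal U).

Lemma sub_ideal_span U : U `<=` ideal_span U.
Proof. by move=> x Ux J [_ _]; apply. Qed.

Lemma ideal_span_sub U J :
  closed J -> lie_ideal [set: L] J -> U `<=` J -> ideal_span U `<=` J.
Proof. by move=> Jc Ji UJ x; apply. Qed.

Section Construction.
Context {W : eqType} (le : rel W).
Hypothesis wo : well_order le.
Local Notation lt := (olt le).

(* Adjoining the radicals of all earlier stages at once covers the zero,
   successor and limit steps by one formula. *)
Definition radical_tower : W -> closedIdeal L :=
  Fix (wo_wf wo) (fun=> closedIdeal L) (fun w c => ideal_span_cideal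
    [set x | exists v (vw : lt v w), quot_rad (c v vw) x]).

Lemma radical_towerE w : closedIdeal_set (radical_tower w) =
  ideal_span (\bigcup_(v in [set v | lt v w]) quot_rad (radical_tower v)).
Proof.
rewrite {1}/radical_tower Fix_eq => [|v f g fg] /=; last first.
  by congr ideal_span_cideal; apply/seteqP; split=> x [u [uv]];
    [rewrite fg|rewrite -fg] => ?; exists u, uv.
by congr ideal_span; apply/seteqP; split=> x; [move=> [v [vw]]|move=> [v vw]];
  exists v => //; exists vw.
Qed.

Lemma quot_rad_tower_sub v w :
  lt v w -> quot_rad (radical_tower v) `<=` radical_tower w.
Proof.
by move=> vw x Qx; rewrite radical_towerE; apply: sub_ideal_span; exists v.
Qed.

Lemma tower_sub v w : le v w -> radical_tower v `<=` radical_tower w.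
Proof.
move=> vw; have [->//|nvw] := eqVneq v w.
apply: (subset_trans (@sub_quot_rad _ _ _)); apply: quot_rad_tower_sub.
exact/andP.
Qed.

Lemma radical_tower_chain : upper_chain (@SAbel_s R) le radical_tower.
Proof.
split=> [w w0|v w vw|w wl].
- rewrite radical_towerE; apply/seteqP; split.
    apply: ideal_span_sub.
    + by apply: accessible_closed_set1; exact: hausdorff_accessible.
    + split=> //; last by move=> a _ _ ->; rewrite lie0r.
      by split=> // a _ _ -> ->; rewrite scaler0 addr0.
    + by move=> x [v /= /(olt_nle wo)/negP]; case.
  by move=> _ ->; have [[]] := ideal_span_ideal
    (\bigcup_(v in [set v | lt v w]) quot_rad (radical_tower v)).
- apply/seteqP; split; last exact: quot_rad_tower_sub vw.1.
  rewrite radical_towerE; apply: ideal_span_sub.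
  + exact: quot_rad_closed.
  + exact: quot_rad_ideal.
  (* Any u < w other than the predecessor v lies below v, so its radical is already in stage v. *)
  + move=> x [u /= uw ux]; have [uv|vu] := eqVneq u v; first by rewrite -uv.
    apply: sub_quot_rad; apply: quot_rad_tower_sub ux.
    apply: nle_olt => //; apply: contraNN vu => vu; apply/eqP.
    apply: (wo_anti wo) => //; apply: contrapT => /negP/(nle_olt wo) /vw.2.
    by move: uw => /(olt_nle wo)/negP.
- apply/seteqP; split; last first.
    apply: closure_sub; first exact: closedIdeal_closed.
    by move=> x [v /= vw]; exact: tower_sub (olt_le vw) _.
  (* A limit leaves room for some u between v and w, and stage u absorbs the radical of stage v. *)
  have sub_between v : lt v w ->
      quot_rad (radical_tower v) `<=` \bigcup_(v in [set v | lt v w]) radical_tower v.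
    move=> vw x Qx; have [u vu uw] := olimit_between wo wl vw.
    by exists u => //; exact: quot_rad_tower_sub Qx.
  have [z zw _] := olimit_gt_nonzero wo wl.
  rewrite radical_towerE; apply: ideal_span_sub; first exact: closed_closure.
    have Us : subspace (\bigcup_(v in [set v | lt v w]) radical_tower v).
      split; first by exists z => //; have [[]] := closedIdeal_ideal (radical_tower z).
      move=> a x y [u uw ux] [v vw vy].
      have [uv|vu] := orP (wo_total wo u v).
        exists v => //; have [[_]] := closedIdeal_ideal (radical_tower v).
        by move=> + _ _; apply=> //; exact: tower_sub ux.
      exists u => //; have [[_]] := closedIdeal_ideal (radical_tower u).
      by move=> + _ _; apply=> //; exact: tower_sub vy.
    split=> //; first exact: subspace_closure.
    move=> a x _; apply: closure_bounded_image (bounded_map_lier a) _ _ => y [v vw vy].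
    exists v => //; have [_ _] := closedIdeal_ideal (radical_tower v); exact.
  by move=> x [v vw Qx]; apply: subset_closure; exact: sub_between Qx.
Qed.

(** If stages v < w agree, the radical of stage v is squeezed between them, so stage v is fixed. *)
Lemma radical_tower_inj :
  (forall w, quot_rad (radical_tower w) <> radical_tower w) ->
  injective (fun w => closedIdeal_set (radical_tower w)).
Proof.
move=> ns v w vw; apply: contrapT => nvw.
wlog lvw : v w vw nvw / le v w.
  by move=> H; have [/H|/H] := orP (wo_total wo v w); apply=> // /esym.
apply: (ns v); apply/seteqP; split; last exact: sub_quot_rad.
by rewrite vw; apply: quot_rad_tower_sub; apply/andP; split=> //; apply/eqP.
Qed.

End Construction.

Lemma cantor (T : Type) (f : set T -> T) : ~ injective f.
Proof.
move=> finj; pose D := [set x | exists2 A, f A = x & ~ A x].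
have nD : ~ D (f D) by move=> DD; have [A /finj AD] := DD; rewrite AD.
by apply: (nD); exists D.
Qed.

(* A tower indexed by a well-ordering of [set (set L)] cannot grow strictly,
   since its stages lie in [set L]. *)
Lemma exists_fixed_tower : exists (W : eqType) (le : rel W) (wo : well_order le) w,
  quot_rad (radical_tower wo w) = radical_tower wo w.
Proof.
have [le wo] := well_ordering_principle {classic set (set L)}.
exists {classic set (set L)}, le, wo; apply: contrapT => nw.
apply: (@cantor (set L) (fun A => radical_tower wo A)).
by apply: radical_tower_inj => w Ew; apply: nw; exists w.
Qed.

(** Every stage lies in [P]; a fixed stage is primitive and so contains [P]. *)
Lemma rad_star_PV : rad_star (@SAbel_s R) L = P.
Proof.
apply/seteqP; split=> [x [W [le [c [w [wo cP _ cx]]]]]|x Px].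
  exact: upper_chain_sub wo cP _ cx.
have [W [le [wo [w Ew]]]] := exists_fixed_tower.
exists W, le, (radical_tower wo), w; split=> //; first exact: radical_tower_chain.
exact: PV_sub_primitive (quot_rad_fixed_primitive Ew) _ Px.
Qed.

End UpperChain.

Theorem theorem6p24 (R : realType) (L : banachLieType R) :
  rad_star (@SAbel_s R) L = rad_circ (@PV R) L.
Proof. by rewrite rad_star_PV rad_circ_PV. Qed.
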